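(* For any rational polygonal Andreev billiard $\Omega(B^\pm)$ and almost any direction $\theta\in S^1$ (with respect to the Lebesgue measure), the flow $\Phi_\pm^t|_{M_\theta^\pm}$ is closed; that is, for every point $z\in M_\theta^\pm$ at which the flow is defined for all times there is $T>0$ with $\Phi_\pm^T(z)=z$.
   Context: Polygonal Andreev billiard: let $\Omega(B^+)$ be a polygonal billiard, i.e. a compact region in the plane whose boundary $B^+$ is a polygon. Let $A^+\subseteq B^+$ be a nonempty connected $C^1$ subset which is a vertical segment of $B^+$ and contains no singularities (corners) of the billiard flow. Let $\rho$ be the reflection of the plane through a line parallel to $A^+$ that does not meet the interior of $\Omega(B^+)$, and put $\Omega(B^-)=\rho(\Omega(B^+))$, $B^-=\rho(B^+)$, $A^-=\rho(A^+)$. The regions $\Omega(B^+)$ and $\Omega(B^-)$ are regarded as two copies of a billiard table, and are glued along $A^+$ and $A^-$ according to the relation $\sim_\pm$ below. Write $\Omega(B^\pm)=\Omega(B^+)\cup\Omega(B^-)$ and $B^\pm=B^+\cup B^-$; $A^+\cup A^-$ is called the Andreev subset. The polygonal Andreev billiard is rational if $B^+$ is a rational polygon, meaning that its interior angles are rational multiples of $\pi$. Relation $\sim_\pm$: directions are angles $\theta\in S^1$ measured from the positive horizontal axis, and at a boundary point $\mathbf{x}$, $r(\theta)$ denotes the reflection of $\theta$ through the tangent line at $\mathbf{x}$ (so for a vertical side $r(\theta)=\pi-\theta$). On $(\Omega(B^+)\cup\Omega(B^-))\times S^1$, $(\mathbf{x},\theta)\sim_\pm(\mathbf{y},\gamma)$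 if and only if one of the following holds: (i) $\mathbf{x},\mathbf{y}\in\Omega(B^+)^\circ\cup\Omega(B^-)^\circ$ and $(\mathbf{x},\theta)=(\mathbf{y},\gamma)$; (ii) $\mathbf{x},\mathbf{y}\in(B^+\cup B^-)\setminus(A^+\cup A^-)$, $\mathbf{x}=\mathbf{y}$, and $\theta=\gamma$ or $\theta=r(\gamma)$; (iii) $\mathbf{x},\mathbf{y}\in A^+\cup A^-$, and either $\mathbf{x}=\mathbf{y}$ and $\theta=\gamma$, or $\mathbf{x}=\rho(\mathbf{y})$ and $\theta=r(\gamma)+\pi$. A class over a boundary point is represented by a pair $(\mathbf{x},\theta)$ with $\theta$ inward pointing at $\mathbf{x}$. Flow $\Phi_\pm^t$ on $(\Omega(B^\pm)\times S^1)/\!\sim_\pm$: a point mass moves with unit speed in a straight line in its direction $\theta$ inside $\Omega(B^+)$ or $\Omega(B^-)$. On reaching a point of $B^\pm\setminus(A^+\cup A^-)$ with direction $\theta$ it continues with direction $r(\theta)$ (the law of reflection). On reaching a point $\mathbf{y}\in A^+$ (resp. $A^-$) with direction $\theta$ it continues in the other copy from $\rho(\mathbf{y})$ with direction $r(\theta)+\pi$. The flow is defined for all $t\in\mathbb{R}$ as long as the trajectory does not meet a corner. For a fixed direction $\theta$, $M_\theta^\pm:=(\Omega(B^\pm)\times\{\theta,\theta_1,\dots,\theta_n\})/\!\sim_\pm\ \subseteq(\Omega(B^\pm)\times S^1)/\!\sim_\pm$, where $\theta_1,\dots,\theta_n$ are all the possible directions (finitely many, since the polygon is rational) taken by the billiard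 ball, with initial direction $\theta$, after colliding in the sides of $\Omega(B^\pm)$. *)

(* Defs.v *)
From mathcomp Require Import all_boot all_order all_algebra.
From mathcomp Require Import all_classical all_reals all_analysis.
Import Order.TTheory GRing.Theory Num.Theory.
Import numFieldNormedType.Exports.

Set Implicit Arguments.
Unset Strict Implicit.
Unset Printing Implicit Defensive.

Local Open Scope classical_set_scope.
Local Open Scope ring_scope.

(** * Plane geometry *)
Section plane.
Variable R : realType.
Local Notation plane := (R * R)%type.
Implicit Types p q u d : plane.

Definition dotp p q : R := p.1 * q.1 + p.2 * q.2.
Definition crossp p q : R := p.1 * q.2 - p.2 * q.1.

(* The angle t of the circle R/2piZ is represented by the unit vector [dir t];
   t + pi is then represented by [- dir t]. *)
Definition dir (t : R) : plane := (cos t, sin t).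
Definition circle : set plane := range dir.

(* Reflection of a direction through a line with direction vector u <> 0;
   for u vertical it maps [dir t] to [dir (pi - t)]. *)
Definition reflect_dir u d : plane := (2 * dotp d u / dotp u u) *: u - d.

(* Reflection of the plane through the vertical line of abscissa c. *)
Definition reflect_vert (c : R) p : plane := (2 * c - p.1, p.2).

Definition segment p q : set plane :=
  [set (1 - t) *: p + t *: q | t in [set t : R | 0 <= t <= 1]].

Definition boundary (X : set plane) : set plane := closure X `\` X°.

(** * Polygons: vertices are listed in cyclic order, and [ordS i] is the
    successor of i in that order. *)
Section polygon.
Variables (n : nat) (v : 'I_n -> plane).

Definition side (i : 'I_n) : set plane := segment (v i) (v (ordS i)).

(* Simple closed polygonal curve.  Consecutive sides are not aligned, so that
   every vertex is a genuine corner. *)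
Definition simple_polygon : Prop :=
  [/\ (3 <= n)%N,
      forall i, crossp (v (ordS i) - v i) (v (ordS (ordS i)) - v (ordS i)) != 0,
      forall i, side i `&` side (ordS i) = [set v (ordS i)]
    & forall i j, j != i -> j != ordS i -> i != ordS j ->
        side i `&` side j = set0].

End polygon.

(* X has interior angle a at its boundary point p: close to p, it is a sector
   of opening a, bounded by the rays of angles t and t + a. *)
Definition has_interior_angle (X : set plane) p (a : R) : Prop :=
  0 < a < 2 * pi /\
  exists t : R, \forall r \near (0 : R)^'+,
    forall s, 0 <= s < 2 * pi -> (X (p + r *: dir (t + s)) <-> s <= a).

End plane.

(** * Polygonal Andreev billiards *)
Record andreev_billiard (R : realType) := AndreevBilliard {
  nsides : nat;
  vertex : 'I_nsides -> R * R;
  table : set (R * R);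
  andreev : set (R * R);
  axis : R;
  _ : simple_polygon vertex;
  (* [table] is a compact region (the closure of a connected open set) bounded
     by the polygon *)
  _ : compact table;
  _ : connected table°;
  _ : closure table° = table;
  _ : boundary table = \bigcup_i side vertex i;
  (* [andreev] is a nondegenerate vertical segment, with or without its
     endpoints, in the boundary, and contains no corner *)
  _ : andreev `<=` boundary table;
  _ : connected andreev;
  _ : exists p q, [/\ andreev p, andreev q & p != q];
  _ : forall p q, andreev p -> andreev q -> p.1 = q.1;
  _ : forall i, ~ andreev (vertex i);
  (* the line of abscissa [axis] does not meet the interior of the table *)
  _ : forall p, table° p -> p.1 != axis }.

Arguments vertex {R} P i : rename.

Section andreev_flow.
Variables (R : realType) (P : andreev_billiard R).
Local Notation plane := (R * R)%type.

Definition rational_billiard : Prop :=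
  forall i, exists2 a : R, has_interior_angle (table P) (vertex P i) a &
    exists q : rat, a = ratr q * pi.

Definition rho : plane -> plane := reflect_vert (axis P).

(* The two tables are regarded as distinct copies, even when the line of
   reflection touches them and they overlap along it: a point is always
   considered together with the copy it belongs to, [true] for the original
   table (+) and [false] for its mirror image (-). *)
Definition tableC (b : bool) : set plane :=
  if b then table P else rho @` table P.
Definition boundaryC (b : bool) : set plane :=
  if b then boundary (table P) else rho @` boundary (table P).
Definition andreevC (b : bool) : set plane :=
  if b then andreev P else rho @` andreev P.
Definition vertexC (b : bool) (i : 'I_(nsides P)) : plane :=
  if b then vertex P i else rho (vertex P i).

(* d' = r(d), the reflection being through the tangent line at the boundary
   point x of copy b; there is no such d' when x is a corner. *)
Definition reflected (b : bool) (x d d' : plane) : Prop :=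
  exists i, [/\ side (vertexC b) i x, forall j, x <> vertexC b j
    & d' = reflect_dir (vertexC b (ordS i) - vertexC b i) d].

Record state := State { copy : bool; pos : plane; vel : plane }.
Implicit Types z w p q : state.

Definition is_state z : Prop := tableC (copy z) (pos z) /\ circle (vel z).

Definition in_interior z : Prop := (tableC (copy z))° (pos z).
Definition on_wall z : Prop :=
  (boundaryC (copy z) `\` andreevC (copy z)) (pos z).
Definition on_andreev z : Prop := andreevC (copy z) (pos z).

(* The relation by which the two copies are glued. *)
Definition glued z w : Prop :=
  [\/ [/\ in_interior z, in_interior w & z = w],
      [/\ on_wall z, on_wall w, copy z = copy w, pos z = pos w
        & vel z = vel w \/ reflected (copy w) (pos w) (vel w) (vel z)]
    | [/\ on_andreev z, on_andreev w &
          z = w \/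
          [/\ copy z = ~~ copy w, pos z = rho (pos w)
            & reflected (copy w) (pos w) (vel w) (- vel z)]]].

(* Points of the quotient are equivalence classes. *)
Definition class z : set state := [set w | is_state w /\ glued z w].

Definition advance (s : R) z : state :=
  State (copy z) (pos z + s *: vel z) (vel z).

(* Change of state when a boundary point is reached: p is the state before the
   collision, q the state after it. *)
Definition collides p q : Prop :=
  (on_wall p /\
   [/\ copy q = copy p, pos q = pos p
     & reflected (copy p) (pos p) (vel p) (vel q)]) \/
  (on_andreev p /\
   [/\ copy q = ~~ copy p, pos q = rho (pos p)
     & reflected (copy p) (pos p) (vel p) (- vel q)]).

(* c is a motion of the point mass on the open time interval ]a, b[.  At a
   collision time t, [c t] is the state after the collision (the inward pointing
   representative of its class) and p is the state before it.  Corners are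
   not allowed, since [collides] never holds at them. *)
Definition motion (a b : R) (c : R -> state) : Prop :=
  forall t, a < t < b ->
    (\forall s \near (0 : R)^'+,
       c (t + s) = advance s (c t) /\ in_interior (c (t + s))) /\
    exists2 p, (in_interior p /\ p = c t) \/ collides p (c t) &
      \forall s \near (0 : R)^'+,
        c (t - s) = advance (- s) p /\ in_interior (c (t - s)).

(* Graph of the partially defined time-t map of the flow on the quotient. *)
Definition flow (t : R) (Z W : set state) : Prop :=
  exists a b c, [/\ a < 0 < b, a < t < b, motion a b c
    & [/\ is_state (c 0), Z = class (c 0) & W = class (c t)]].

(* Directions that the ball can take, from the direction d0, by collisions in
   the sides of the two tables. *)
Inductive possible_direction (d0 : plane) : plane -> Prop :=
| possible_start : possible_direction d0 d0
| possible_collision p q : possible_direction d0 (vel p) -> collides p q ->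
    possible_direction d0 (vel q).

Definition invariant_surface (theta : R) : set (set state) :=
  [set class z | z in [set z | tableC (copy z) (pos z) /\
                               possible_direction (dir theta) (vel z)]].

(* The flow restricted to the set M of classes is closed. *)
Definition closed_flow (M : set (set state)) : Prop :=
  forall Z, M Z -> (forall t, exists W, flow t Z W) ->
    exists2 T, 0 < T & flow T Z Z.

End andreev_flow.

(* Main.v *)
(** Fold the mirror copy onto the table by [rho].  A collision with the Andreev
    set then just reverses the velocity, so after it the trajectory runs back
    along its own past (in the other copy) until it meets the Andreev set
    again.  Hence a trajectory that meets it both in the future and in the past
    is closed, and everything reduces to recurrence: away from a countable set
    of directions, every trajectory of the ordinary billiard in the folded
    table meets the Andreev segment within bounded time.

    Call singular the corners and the two endpoints of the Andreev segment.  By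
    unfolding, a trajectory joining two singular points has one of countably
    many directions; these are excluded.  Rationality makes the set of
    directions of a trajectory finite.  Then:
    - only finitely many points of the segment run into a singular point before
      returning to it, and on each interval between them all itineraries agree
      until the return.  Such an interval is transported isometrically (for the
      transverse measure), so by the pigeonhole principle two of its images
      overlap, and running backwards the interval returns after boundedly many
      bounces;
    - for each direction [d], the set of the interior points whose trajectory
      in direction [d] or [- d] meets the segment is open, and it is closed since
      no trajectory joins two singular points; so it is all of the interior. *)

Require Import Defs.
From mathcomp Require Import all_boot all_order all_algebra.
From mathcomp Require Import all_classical all_reals all_analysis.
From mathcomp Require Import ring lra.
Import Order.TTheory GRing.Theory Num.Theory.
Import numFieldNormedType.Exports.

Set Implicit Arguments.
Unset Strict Implicit.
Unset Printing Implicit Defensive.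

Local Open Scope classical_set_scope.
Local Open Scope ring_scope.

(** * Plane geometry and the boundary of the table *)

(** No motion is ever constructed: a given one is compared with finite words of bounces, whose
    stability, reversal and injectivity are proved by induction. A bound on bounces is a bound on
    time, since the size of the table bounds every flight. The connected set has to allow both signs
    of a direction: a limit of trajectories that reach the segment may itself run into a singular
    point, but not in both directions. That it is nonempty is passed from one direction to the next
    by reflection in the sides. This starts on the segment, from which the initial direction or its
    opposite points into the table unless it is vertical, so the two vertical directions are
    excluded as well. A motion may bounce at an endpoint of the segment lying outside the Andreev
    set, although this point is singular. Its continuation then has a singular point in its past and
    cannot meet another one before the Andreev set. Only future collisions are looked for: after the
    first one the motion runs through its own past. Collisions at times [t1] and [t2] are symmetries
    of the motion in time, which compose to a translation by [2 * (t2 - t1)]. *)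

Section plane_geometry.
Variable R : realType.
Local Notation plane := (R * R)%type.
Implicit Types p q u d : plane.

Lemma fstZ (s : R) p : (s *: p).1 = s * p.1. Proof. by []. Qed.
Lemma sndZ (s : R) p : (s *: p).2 = s * p.2. Proof. by []. Qed.
Lemma fstD p q : (p + q).1 = p.1 + q.1. Proof. by []. Qed.
Lemma sndD p q : (p + q).2 = p.2 + q.2. Proof. by []. Qed.
Lemma fstN p : (- p).1 = - p.1. Proof. by []. Qed.
Lemma sndN p : (- p).2 = - p.2. Proof. by []. Qed.
Definition planeE := (fstZ, sndZ, fstD, sndD, fstN, sndN).
Lemma plane_eq p q : p.1 = q.1 -> p.2 = q.2 -> p = q.
Proof. by case: p q => [a b] [c d] /= -> ->. Qed.

Lemma crosspD u p q : crossp u (p + q) = crossp u p + crossp u q.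
Proof. rewrite /crossp !planeE; ring. Qed.
Lemma crosspB u p q : crossp u (p - q) = crossp u p - crossp u q.
Proof. rewrite /crossp !planeE; ring. Qed.
Lemma crosspZ u s p : crossp u (s *: p) = s * crossp u p.
Proof. rewrite /crossp !planeE; ring. Qed.
Lemma crosspN u p : crossp u (- p) = - crossp u p.
Proof. rewrite /crossp !planeE; ring. Qed.
Lemma crosspC p q : crossp p q = - crossp q p.
Proof. rewrite /crossp; ring. Qed.
Lemma crosspp p : crossp p p = 0.
Proof. rewrite /crossp; ring. Qed.

Lemma dotp_gt0 u : u != 0 -> 0 < dotp u u.
Proof.
move=> u0; rewrite /dotp -!expr2 lt_neqAle addr_ge0 ?sqr_ge0 // andbT eq_sym.
apply: contra u0; rewrite paddr_eq0 ?sqr_ge0 // !sqrf_eq0 => /andP[/eqP a /eqP b].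
by apply/eqP/plane_eq.
Qed.

Lemma reflect_dirK u d : u != 0 -> reflect_dir u (reflect_dir u d) = d.
Proof.
move=> /dotp_gt0 /lt0r_neq0; rewrite /reflect_dir/dotp => h.
by apply: plane_eq; rewrite !planeE; field.
Qed.
Lemma reflect_dirN u d : reflect_dir u (- d) = - reflect_dir u d.
Proof.
rewrite /reflect_dir/dotp.
by apply: plane_eq; rewrite !planeE; ring.
Qed.
Lemma dotp_reflect u d : u != 0 ->
  dotp (reflect_dir u d) (reflect_dir u d) = dotp d d.
Proof.
move=> /dotp_gt0 /lt0r_neq0; rewrite /reflect_dir/dotp => h.
by rewrite !planeE; field.
Qed.
Lemma crossp_reflect u d : u != 0 -> crossp u (reflect_dir u d) = - crossp u d.
Proof.
move=> /dotp_gt0 /lt0r_neq0; rewrite /reflect_dir/dotp/crossp => h.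
by rewrite !planeE; field.
Qed.
Lemma reflect_dir_par u d : u != 0 -> crossp u d = 0 -> reflect_dir u d = d.
Proof.
move=> u0; have /lt0r_neq0 := dotp_gt0 u0.
rewrite /crossp /reflect_dir /dotp => h c0.
apply: plane_eq; rewrite !planeE.
- transitivity (d.1 + 2 * u.2 * (u.1 * d.2 - u.2 * d.1) / (u.1 * u.1 + u.2 * u.2)).
    by field.
  by rewrite c0; ring.
- transitivity (d.2 - 2 * u.1 * (u.1 * d.2 - u.2 * d.1) / (u.1 * u.1 + u.2 * u.2)).
    by field.
  by rewrite c0; ring.
Qed.
Lemma reflect_dir_vert u d : u != 0 -> u.1 = 0 -> reflect_dir u d = (- d.1, d.2).
Proof.
move=> u0 u1; have /lt0r_neq0 := dotp_gt0 u0.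
rewrite /reflect_dir /dotp u1 => h; apply: plane_eq; rewrite !planeE /= ?u1; last first.
  by field; apply: contra_neq h => ->; ring.
by ring.
Qed.
Lemma crossp_eq0 u p : u != 0 -> crossp u p = 0 ->
  p = (dotp p u / dotp u u) *: u.
Proof.
move=> u0; have /lt0r_neq0 := dotp_gt0 u0.
rewrite /crossp /dotp => h c0.
apply: plane_eq; rewrite !planeE.
- transitivity ((p.1 * u.1 + p.2 * u.2) / (u.1 * u.1 + u.2 * u.2) * u.1 -
      u.2 * (u.1 * p.2 - u.2 * p.1) / (u.1 * u.1 + u.2 * u.2)).
    by field.
  by rewrite c0; ring.
- transitivity ((p.1 * u.1 + p.2 * u.2) / (u.1 * u.1 + u.2 * u.2) * u.2 +
      u.1 * (u.1 * p.2 - u.2 * p.1) / (u.1 * u.1 + u.2 * u.2)).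
    by field.
  by rewrite c0; ring.
Qed.

Lemma lt_two (a b : R) : 0 < a -> 0 < b -> exists s, [/\ 0 < s, s < a & s < b].
Proof.
move=> a0 b0; have m0 : 0 < Num.min a b by rewrite lt_min a0.
have ma : Num.min a b <= a by rewrite ge_min lexx.
have mb : Num.min a b <= b by rewrite ge_min lexx orbT.
by exists (Num.min a b / 2); split; lra.
Qed.

(** The open ball of the product norm, spelled out by coordinates so that linear arithmetic
    applies. *)
Definition sq p (e : R) q := `|q.1 - p.1| < e /\ `|q.2 - p.2| < e.

Lemma nbhs_sq p (A : set plane) : nbhs p A <-> exists2 e, 0 < e & forall q, sq p e q -> A q.
Proof.
split=> [/nbhs_ballP[e e0 H]|[e e0 H]].
  exists e => // q [h1 h2]; apply: H.
  by rewrite distrC in h1; rewrite distrC in h2; split.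
apply/nbhs_ballP; exists e => // q [h1 h2]; apply: H.
by split; rewrite distrC; [exact: h1|exact: h2].
Qed.

Lemma sqW p e e' q : e <= e' -> sq p e q -> sq p e' q.
Proof. by move=> ee [h1 h2]; split; lra. Qed.
Lemma sqxx p e : 0 < e -> sq p e p.
Proof. by move=> e0; split; rewrite subrr normr0. Qed.

Lemma along_sq x d e : 0 < e -> exists2 e', 0 < e' & forall s, `|s| < e' -> sq x e (x + s *: d).
Proof.
move=> e0; pose M := `|d.1| + `|d.2| + 1.
have M0 : 0 < M by rewrite /M; have := normr_ge0 d.1; have := normr_ge0 d.2; lra.
exists (e / M) => [|s hs]; first by rewrite divr_gt0.
have h (a : R) : `|a| <= M -> `|s * a| < e.
  move=> aM; rewrite normrM -(divfK (lt0r_neq0 M0) e).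
  apply: le_lt_trans (_ : `|s| * M < _); first by rewrite ler_wpM2l.
  by rewrite ltr_pM2r.
by split; rewrite !planeE addrAC subrr add0r; apply: h; rewrite /M;
  have := normr_ge0 d.1; have := normr_ge0 d.2; lra.
Qed.

(** Stands in for compactness and connectedness of intervals: if [Q] held at the infimum of its
    failures after [a], openness to the right would push that infimum further. *)
Lemma first_time (Q : R -> Prop) (a b : R) : a <= b -> ~ Q b ->
  (forall s, a <= s -> Q s -> exists2 e, 0 < e & forall s', s <= s' < s + e -> Q s') ->
  exists2 t, a <= t <= b & (forall s, a <= s < t -> Q s) /\ ~ Q t.
Proof.
move=> ab Qb Qo; pose E := [set s | a <= s /\ ~ Q s].
have hE : has_inf E by split; [exists b | exists a => s []].
have Et s : a <= s < inf E -> Q s.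
  move=> /andP[as_ sE]; apply: contrapT => nQ.
  have : inf E <= s by apply: ge_inf; [exists a => ? [] | split].
  lra.
have aE : a <= inf E by apply: lb_le_inf; [exists b | move=> s []].
have Eb : inf E <= b by apply: ge_inf; [exists a => ? [] | split].
exists (inf E); first by rewrite aE Eb.
split=> // QE; have [e e0 H] := Qo _ aE QE.
have [s [as_ nQs] sE] := inf_adherent e0 hE.
apply: nQs; have [sl|sl] := ltP s (inf E); first by apply: Et; rewrite as_ sl.
by apply: H; rewrite sl sE.
Qed.
End plane_geometry.

Section table.
Variables (R : realType) (P : andreev_billiard R).
Local Notation plane := (R * R)%type.
Implicit Types p q u d x y : plane.
Local Notation T := (table P).
Local Notation O := (table P)°.

Lemma billiard_polygon : simple_polygon (vertex P). Proof. by case: P. Qed.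
Lemma table_compact : compact T. Proof. by case: P. Qed.
Lemma table_connected : connected O. Proof. by case: P. Qed.
Lemma table_closure : closure O = T. Proof. by case: P. Qed.
Lemma table_boundary : boundary T = \bigcup_i side (vertex P) i.
Proof. by case: P. Qed.
Lemma andreev_boundary : andreev P `<=` boundary T. Proof. by case: P. Qed.
Lemma andreev_connected : connected (andreev P). Proof. by case: P. Qed.
Lemma andreev_two : exists p q, [/\ andreev P p, andreev P q & p != q].
Proof. by case: P. Qed.
Lemma andreev_vertical p q : andreev P p -> andreev P q -> p.1 = q.1.
Proof. by case: P p q. Qed.
Lemma andreev_vertex i : ~ andreev P (vertex P i). Proof. by case: P i. Qed.

Lemma table_closed : closed T.
Proof. by rewrite -table_closure; exact: closed_closure. Qed.

Lemma interior_sq x : O x <-> exists2 e, 0 < e & forall p, sq x e p -> T p.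
Proof. exact: nbhs_sq. Qed.

Lemma interior_nbhs x : O x -> exists2 e, 0 < e & forall p, sq x e p -> O p.
Proof.
move=> Ox; apply/nbhs_sq.
by apply: open_nbhs_nbhs; split => //; exact: open_interior.
Qed.

Lemma interiorT x : O x -> T x. Proof. exact: interior_subset. Qed.

Lemma closure_sq (A : set plane) x : closure A x <-> forall e, 0 < e -> exists2 p, sq x e p & A p.
Proof.
split=> [cA e e0|H B /nbhs_sq[e e0 B_]].
  have [|p [Ap xp]] := cA (sq x e); first by apply/nbhs_sq; exists e.
  by exists p.
by have [p xp Ap] := H _ e0; exists p; split => //; exact: B_.
Qed.

Lemma table_lim x : (forall e, 0 < e -> exists2 p, sq x e p & T p) -> T x.
Proof. by move=> H; apply: table_closed; apply/closure_sq. Qed.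

Lemma table_approx x : T x -> forall e, 0 < e -> exists2 p, sq x e p & O p.
Proof. by rewrite -{1}table_closure => /closure_sq. Qed.

Lemma boundaryE x : boundary T x <-> T x /\ ~ O x.
Proof. by rewrite /boundary -(closure_id T).1; [split|exact: table_closed]. Qed.

Lemma boundary_side x : boundary T x <-> exists i, side (vertex P) i x.
Proof. by rewrite table_boundary; split=> [[i _]|[i]]; exists i. Qed.

Lemma table_bounded : exists2 M, 0 < M & forall x, T x -> `|x.1| <= M /\ `|x.2| <= M.
Proof.
have [N [Nr HN]] := compact_bounded table_compact.
exists (`|N| + 1); first by rewrite ltr_wpDl.
move=> x Tx; have : `|x| <= `|N| + 1.
  by apply: HN => //; rewrite ltr_pwDr // ler_norm.
by rewrite prod_normE ge_max => /andP.
Qed.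

Lemma exit_boundary x d (t : R) : 0 < t -> (forall s, 0 < s < t -> O (x + s *: d)) ->
  ~ O (x + t *: d) -> boundary T (x + t *: d).
Proof.
move=> t0 H nO; apply/boundaryE; split => //; apply: table_lim => e e0.
have [r' r'0 Hr] := along_sq (x + t *: d) d e0.
have [r [r0 rr' rt]] := lt_two r'0 t0.
exists (x + (t - r) *: d); last by apply/interiorT/H; lra.
have -> : x + (t - r) *: d = x + t *: d + (- r) *: d.
  by apply: plane_eq; rewrite !planeE; ring.
by apply: Hr; rewrite normrN gtr0_norm.
Qed.

Lemma open_along x d (s : R) : O (x + s *: d) ->
  exists2 e, 0 < e & forall s', s - e < s' < s + e -> O (x + s' *: d).
Proof.
move=> /interior_nbhs[e e0 H]; have [r r0 Hr] := along_sq (x + s *: d) d e0.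
exists r => // s' hs'; apply: H.
have -> : x + s' *: d = x + s *: d + (s' - s) *: d.
  by apply: plane_eq; rewrite !planeE; ring.
by apply: Hr; rewrite ltr_norml; lra.
Qed.

Lemma first_exit x d (a b : R) : a <= b -> ~ O (x + b *: d) ->
  exists2 t, a <= t <= b & (forall s, a <= s < t -> O (x + s *: d)) /\ ~ O (x + t *: d).
Proof.
move=> ab nO; apply: (@first_time R (fun s => O (x + s *: d))) => // s _ /open_along[e e0 H].
by exists e => // s' hs'; apply: H; lra.
Qed.

(* Locked, so that [planeE] does not look through it. *)
Definition edge i : plane := locked (vertex P (ordS i) - vertex P i).
Lemma edgeE i : edge i = vertex P (ordS i) - vertex P i.
Proof. by rewrite /edge -lock. Qed.

Lemma edge_neq0 i : edge i != 0.
Proof.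
have [_ H _ _] := billiard_polygon; apply: contra_neq (H i).
by rewrite -edgeE => ->; rewrite /crossp /=; ring.
Qed.

Lemma sideP i p : side (vertex P) i p <->
  exists2 t, 0 <= t <= 1 & p = vertex P i + t *: edge i.
Proof.
have e t : (1 - t) *: vertex P i + t *: vertex P (ordS i) = vertex P i + t *: edge i.
  by rewrite edgeE; apply: plane_eq; rewrite !planeE; ring.
split=> [[t ht <-]|[t ht ->]]; exists t => //; rewrite e //.
Qed.

Lemma side_vertex i : side (vertex P) i (vertex P i).
Proof. by apply/sideP; exists 0; [lra|rewrite scale0r addr0]. Qed.

Lemma side_crossp i p q : side (vertex P) i p -> side (vertex P) i q ->
  crossp (edge i) (p - q) = 0.
Proof.
move=> /sideP[t _ ->] /sideP[t' _ ->].
by rewrite crosspB !crosspD !crosspZ crosspp; ring.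
Qed.

Lemma side_inj i j p : side (vertex P) i p -> side (vertex P) j p ->
  (forall k, p <> vertex P k) -> i = j.
Proof.
have [_ _ H1 H2] := billiard_polygon => si sj nv.
apply: contrapT => /eqP ij.
have [ji|ji] := eqVneq j (ordS i).
  have : (side (vertex P) i `&` side (vertex P) (ordS i)) p by rewrite -ji.
  by rewrite H1 => /nv.
have [ji'|ji'] := eqVneq i (ordS j).
  have : (side (vertex P) j `&` side (vertex P) (ordS j)) p by rewrite -ji'.
  by rewrite H1 => /nv.
have : (side (vertex P) i `&` side (vertex P) j) p by [].
by rewrite H2 // eq_sym.
Qed.

Lemma side_closed i : closed (side (vertex P) i).
Proof.
apply: compact_closed; first exact: norm_hausdorff.
rewrite /side /segment.
have -> : [set t : R | 0 <= t <= 1] = `[0, 1]%classic by apply/seteqP; split => t /=; rewrite in_itv.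
apply: continuous_compact; last exact: segment_compact.
apply: continuous_subspaceT => t.
apply: cvgD; apply: cvgZr_tmp => //; apply: cvgB => //; exact: cvg_cst.
Qed.

Lemma closed_avoid (A : set plane) y : closed A -> ~ A y ->
  exists2 e, 0 < e & forall p, sq y e p -> ~ A p.
Proof.
move=> cA nA; apply: contrapT => H; apply: nA; apply: cA; apply/closure_sq => e e0.
apply: contrapT => H'; apply: H; exists e => // p yp Ap; apply: H'; by exists p.
Qed.

Lemma sq_forall (I : finType) (Q : I -> plane -> Prop) y :
  (forall i, exists2 e, 0 < e & forall p, sq y e p -> Q i p) ->
  exists2 e, 0 < e & forall p, sq y e p -> forall i, Q i p.
Proof.
move=> H; apply/nbhs_sq; have := @filter_forall _ I Q (nbhs y) _.
by apply => i; apply/nbhs_sq.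
Qed.

Lemma sq_avoid y q : q <> y -> exists2 e, 0 < e & forall p, sq y e p -> p <> q.
Proof.
move=> qy; exists (Num.max `|q.1 - y.1| `|q.2 - y.2|).
  rewrite lt_max !normr_gt0 !subr_eq0 -negb_and; apply/negP => /andP[/eqP a /eqP b].
  by apply: qy; exact: plane_eq.
move=> p [h1 h2] pq; move: h1 h2; rewrite pq !lt_max !ltxx orbF /= => h1 h2.
by have := lt_trans h1 h2; rewrite ltxx.
Qed.

Lemma sq_open y e p : sq y e p -> exists2 e', 0 < e' & forall q, sq p e' q -> sq y e q.
Proof.
move=> [h1 h2]; exists (Num.min (e - `|p.1 - y.1|) (e - `|p.2 - y.2|)).
  by rewrite lt_min !subr_gt0 h1.
move=> q [a b]; split.
  have : `|q.1 - p.1| < e - `|p.1 - y.1| by apply: lt_le_trans a _; rewrite ge_min lexx.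
  have := ler_normD (q.1 - p.1) (p.1 - y.1).
  have -> : q.1 - p.1 + (p.1 - y.1) = q.1 - y.1 by ring.
  lra.
have : `|q.2 - p.2| < e - `|p.2 - y.2| by apply: lt_le_trans b _; rewrite ge_min lexx orbT.
have := ler_normD (q.2 - p.2) (p.2 - y.2).
have -> : q.2 - p.2 + (p.2 - y.2) = q.2 - y.2 by ring.
lra.
Qed.

Lemma crossp_cont u y e : 0 < e ->
  exists2 e', 0 < e' & forall p, sq y e' p -> `|crossp u (p - y)| < e.
Proof.
move=> e0; pose M := `|u.1| + `|u.2| + 1.
have M0 : 0 < M by rewrite /M; have := normr_ge0 u.1; have := normr_ge0 u.2; lra.
have eM : 0 < e / M by rewrite divr_gt0.
exists (e / M) => // p [h1 h2]; rewrite /crossp !planeE.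
apply: le_lt_trans (ler_normB _ _) _; rewrite !normrM.
apply: le_lt_trans (_ : `|u.1| * (e / M) + `|u.2| * (e / M) < _).
  by apply: lerD; rewrite ler_wpM2l // ltW.
rewrite -mulrDl -[X in _ < X](divfK (lt0r_neq0 M0)) mulrC ltr_pM2l // /M; lra.
Qed.

Lemma small_multiple u : u != 0 ->
  exists2 M, 0 < M & forall l c y, sq y (c * M) (y + l *: u) -> `|l| < c.
Proof.
move=> u0; have M0 : 0 < Num.max `|u.1| `|u.2|.
  rewrite lt_max !normr_gt0 -negb_and; apply: contra u0 => /andP[/eqP a /eqP b].
  by apply/eqP/plane_eq.
exists (Num.max `|u.1| `|u.2|) => // l c y [].
rewrite !planeE [y.1 + _]addrC [y.2 + _]addrC !addrK !normrM.
by case: (leP `|u.1| `|u.2|) M0 => h M0 h1 h2; rewrite -(ltr_pM2r M0).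
Qed.

Lemma sq_convex y e p q t : sq y e p -> sq y e q -> 0 <= t <= 1 ->
  sq y e (p + t *: (q - p)).
Proof.
move=> [a b] [c d] ht.
have h (x1 x2 x3 : R) : `|x1 - x3| < e -> `|x2 - x3| < e -> `|x1 + t * (x2 - x1) - x3| < e.
  rewrite !ltr_norml => h1 h2.
  have -> : x1 + t * (x2 - x1) - x3 = (1 - t) * (x1 - x3) + t * (x2 - x3) by ring.
  move: h1 h2 => /andP[h1 h1'] /andP[h2 h2'].
  move: ht => /andP[t0 t1].
  have [tz|tz] := eqVneq t 0; first by rewrite tz; apply/andP; split; lra.
  have {}t0 : 0 < t by rewrite lt_neqAle eq_sym tz.
  by apply/andP; split; nra.
by split; rewrite !planeE; apply: h.
Qed.

(* The sign k puts the interior of the table on the positive side of edge i. *)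
Definition half_disk y i (k e : R) := [/\ side (vertex P) i y, k = 1 \/ k = -1, 0 < e &
  forall p, sq y e p ->
   [/\ O p <-> 0 < k * crossp (edge i) (p - y),
       T p <-> 0 <= k * crossp (edge i) (p - y),
       forall j, side (vertex P) j p -> j = i,
       crossp (edge i) (p - y) = 0 -> side (vertex P) i p
     & forall j, p <> vertex P j]].

(** A small square around [y] meets a single side, whose line cuts it in two halves. Each half is
    entirely interior or entirely not; one of them is, because the table is the closure of its
    interior, and both cannot be, because [y] is a boundary point. *)
Lemma half_disk_exists y : boundary T y -> (forall i, y <> vertex P i) ->
  exists i k e, half_disk y i k e.
Proof.
move=> by_ nv; have [i si] := (boundary_side y).1 by_.
have u0 := edge_neq0 i; set u := edge i in u0 *.
have [e1 e10 H1] : exists2 e, 0 < e & forall p, sq y e p -> forall j, side (vertex P) j p -> j = i.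
  apply: sq_forall => j; have [ji|ji] := pselect (j = i); first by exists 1.
  have [|e e0 H] := @closed_avoid (side (vertex P) j) y (@side_closed j).
    by move=> sj; apply: ji; exact: side_inj sj si nv.
  by exists e => // p yp /(H _ yp).
have [e2 e20 H2] : exists2 e, 0 < e & forall p, sq y e p -> forall j, p <> vertex P j.
  by apply: sq_forall => j; apply: sq_avoid => /esym/nv.
have [e3 e30 H3] : exists2 e, 0 < e & forall p, sq y e p -> crossp u (p - y) = 0 -> side (vertex P) i p.
  have [t /andP[t0 t1] ey] := (sideP i y).1 si.
  have t0' : 0 < t.
    rewrite lt_neqAle t0 andbT; apply/eqP => tt; apply: (nv i).
    by rewrite ey -tt scale0r addr0.
  have t1' : t < 1.
    rewrite lt_neqAle t1 andbT; apply/eqP => tt; apply: (nv (ordS i)).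
    by rewrite ey tt scale1r edgeE addrC subrK.
  pose c := Num.min t (1 - t).
  have c0 : 0 < c by rewrite lt_min t0' subr_gt0.
  have [M M0 HM] := small_multiple u0.
  exists (c * M); first by rewrite mulr_gt0.
  move=> p yp /(crossp_eq0 u0) el.
  have [l ep] : exists l, p = y + l *: u.
    by exists (dotp (p - y) u / dotp u u); rewrite -el addrC subrK.
  have cl : `|l| < c by apply: (HM _ _ y); rewrite -ep.
  apply/sideP; exists (t + l); last by rewrite ep ey scalerDl addrA.
  have ct : c <= t by rewrite ge_min lexx.
  have ct' : c <= 1 - t by rewrite ge_min lexx orbT.
  by move: cl; rewrite ltr_norml; lra.
pose e := Num.min (Num.min e1 e2) e3.
have e0 : 0 < e by rewrite !lt_min e10 e20.
have {}H1 p : sq y e p -> forall j, side (vertex P) j p -> j = i.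
  by move=> /(@sqW _ _ _ e1 _) yp; apply: H1; apply: yp; rewrite !ge_min lexx.
have {}H2 p : sq y e p -> forall j, p <> vertex P j.
  by move=> /(@sqW _ _ _ e2 _) yp; apply: H2; apply: yp; rewrite !ge_min lexx !orbT.
have {}H3 p : sq y e p -> crossp u (p - y) = 0 -> side (vertex P) i p.
  by move=> /(@sqW _ _ _ e3 _) yp; apply: H3; apply: yp; rewrite !ge_min lexx !orbT.
have line p : sq y e p -> crossp u (p - y) = 0 -> T p /\ ~ O p.
  by move=> yp cp; apply/boundaryE/boundary_side; exists i; exact: H3.
have [p0 yp0 Op0] : exists2 p, sq y e p & O p.
  by apply: table_approx => //; case/boundaryE: by_.
(* If the segment from [p] to [q] left the interior, it would meet the boundary inside the square,
   hence on the line of side [i]; but [k * crossp] stays positive along it. *)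
have same k p q : sq y e p -> sq y e q -> 0 < k * crossp u (p - y) ->
    0 < k * crossp u (q - y) -> O p -> O q.
  move=> yp yq kp kq Op; apply: contrapT => nOq.
  have [||t /andP[t0 t1] [Ht nOt]] := @first_exit p (q - p) 0 1.
  - by [].
  - by rewrite scale1r addrC subrK.
  have t0' : 0 < t.
    rewrite lt_neqAle t0 andbT; apply/eqP => t00.
    by apply: nOt; rewrite -t00 scale0r addr0.
  have := @exit_boundary p (q - p) t t0' _ nOt.
  move=> /(_ _) /boundary_side[|j sj]; first by move=> s hs; apply: Ht; lra.
  have yt := sq_convex yp yq (_ : 0 <= t <= 1).
  have ji := H1 _ (yt ltac:(lra)) _ sj.
  have := side_crossp sj (eq_ind_r (fun j => side (vertex P) j y) si ji).
  rewrite ji -/u.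
  have -> : p + t *: (q - p) - y = (1 - t) *: (p - y) + t *: (q - y).
    by apply: plane_eq; rewrite !planeE; ring.
  rewrite crosspD !crosspZ.
  move=> e_; have : k * ((1 - t) * crossp u (p - y) + t * crossp u (q - y)) = 0.
    by rewrite e_ mulr0.
  have : 0 < t * (k * crossp u (q - y)) by rewrite mulr_gt0.
  have : 0 <= (1 - t) * (k * crossp u (p - y)) by rewrite mulr_ge0 ?subr_ge0 // ltW.
  lra.
have cp0 : crossp u (p0 - y) != 0 by apply/eqP => /(line _ yp0) [_ []].
pose k := Num.sg (crossp u (p0 - y)).
have k0 : 0 < k * crossp u (p0 - y) by rewrite -normrEsg normr_gt0.
have k1 : k = 1 \/ k = -1.
  by rewrite /k; case: sgrP cp0 => //; [left|right].
have kk : k * k = 1 by case: k1 => ->; ring.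
have Hp p : sq y e p -> 0 < k * crossp u (p - y) -> O p.
  by move=> yp hp; exact: same k0 hp Op0.
(* An interior point on the negative side would make both halves interior; the line between them
   lies in the table, so [y] would be interior too. *)
have Hn p : sq y e p -> k * crossp u (p - y) < 0 -> ~ O p.
  move=> yp hp Op; have [_] := (boundaryE y).1 by_; apply; apply/interior_sq.
  exists e => // q yq.
  have [hq|hq|hq] := ltrgtP 0 (k * crossp u (q - y)).
  - exact/interiorT/Hp.
  - by apply/interiorT/(@same (- k) p q) => //; rewrite mulNr oppr_gt0.
  - apply: (line _ yq _).1; have : k * (k * crossp u (q - y)) = 0 by rewrite -hq mulr0.
    by rewrite mulrA kk mul1r.
have Hz p : k * crossp u (p - y) = 0 -> crossp u (p - y) = 0.
  by move=> /(congr1 ( *%R k)); rewrite mulrA kk mul1r mulr0.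
have HO p : sq y e p -> O p <-> 0 < k * crossp u (p - y).
  move=> yp; split=> [Op|]; last exact: Hp.
  have [hq|/(Hn _ yp)//|/esym/Hz] := ltrgtP 0 (k * crossp u (p - y)); first by [].
  by move=> /(line _ yp) [].
exists i, k, e; split => // p yp; split; [exact: HO| |exact: H1|exact: H3|exact: H2].
split=> [Tp|].
  rewrite leNgt; apply/negP => hp.
  have [e' e'0 He'] := sq_open yp.
  have [e'' e''0 He''] := @crossp_cont u p (- (k * crossp u (p - y))) ltac:(rewrite oppr_gt0; exact: hp).
  have [|q pq Oq] := table_approx Tp (_ : 0 < Num.min e' e''); first by rewrite lt_min e'0.
  have yq : sq y e q by apply: He'; apply: sqW pq; rewrite ge_min lexx.
  have := (HO _ yq).1 Oq.
  have /He'' : sq p e'' q by apply: sqW pq; rewrite ge_min lexx orbT.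
  have -> : crossp u (q - y) = crossp u (q - p) + crossp u (p - y) by rewrite !crosspB; ring.
  rewrite ltr_norml; case: k1 hp => -> ; lra.
rewrite le_eqVlt => /orP[/eqP/esym/Hz/(line _ yp)[]//|/(HO _ yp).2]; exact: interiorT.
Qed.
End table.

(** * Straight flights *)

Section andreev_segment.
Variables (R : realType) (P : andreev_billiard R).
Local Notation plane := (R * R)%type.
Implicit Types p q u d x y : plane.
Local Notation A := (andreev P).

(** The bounds are the infimum and the supremum of the heights. The Andreev set may or may not
    contain its endpoints, hence a strict inclusion on one side and a weak one on the other. *)
Lemma andreev_interval : exists cA lo hi : R, [/\ lo < hi,
  forall y : R, lo < y < hi -> A (cA, y)
  & forall p, A p -> p.1 = cA /\ lo <= p.2 <= hi].
Proof.
have [p [q [Ap Aq pq]]] := andreev_two P.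
pose Y := snd @` A.
have cY : connected Y.
  apply: connected_continuous_connected; first exact: andreev_connected.
  by apply: continuous_subspaceT => x; exact: cvg_snd.
have iY := (connected_intervalP Y).1 cY.
have [M M0 HM] := table_bounded P.
have bY (y : R) : Y y -> `|y| <= M.
  move=> [a Aa <-]; apply: (HM a _).2.
  by have /boundaryE[] := andreev_boundary Aa.
have Y0 : Y !=set0 by exists p.2, p.
have iv : has_inf Y by split => //; exists (- M) => y /bY; rewrite ler_norml => /andP[].
have sv : has_sup Y by split => //; exists M => y /bY; rewrite ler_norml => /andP[].
have Ylh (y : R) : Y y -> inf Y <= y <= sup Y.
  by move=> Yy; rewrite ge_inf ?ub_le_sup//; [case: sv|case: iv].
have A1 a : A a -> a.1 = p.1 by move=> Aa; exact: (andreev_vertical Aa Ap).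
exists p.1, (inf Y), (sup Y); split.
- have /Ylh/andP[a b] : Y p.2 by exists p.
  have /Ylh/andP[a' b'] : Y q.2 by exists q.
  rewrite lt_neqAle (le_trans a b) andbT; apply/eqP => e.
  by move: pq; apply/negP; rewrite negbK; apply/eqP/plane_eq; [rewrite (A1 q)|lra].
- move=> y /andP[ly yh].
  have e1 : 0 < y - inf Y by rewrite subr_gt0.
  have e2 : 0 < sup Y - y by rewrite subr_gt0.
  have [a Ya ha] := inf_adherent e1 iv.
  have [b Yb hb] := sup_adherent e2 sv.
  have [] : Y y by apply: (iY a b) => //; apply/andP; split; lra.
  by move=> [z1 z2] Az /= <-; rewrite -(A1 _ Az).
- by move=> a Aa; split; [exact: A1|apply: Ylh; exists a].
Qed.
End andreev_segment.

Section dynamics.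
Variables (R : realType) (P : andreev_billiard R) (cA lo hi : R).
Local Notation plane := (R * R)%type.
Implicit Types p q u d x y : plane.
Local Notation T := (table P).
Local Notation O := (table P)°.
Local Notation A := (andreev P).
Local Notation n := (nsides P).

Hypothesis lohi : lo < hi.
Hypothesis A_in : forall y : R, lo < y < hi -> A (cA, y).
Hypothesis A_out : forall p, A p -> p.1 = cA /\ lo <= p.2 <= hi.

Definition singular_point p :=
  (exists i, p = vertex P i) \/ p = (cA, lo) \/ p = (cA, hi).
Local Notation Sig := singular_point.

Lemma A_regular y : A y -> ~ Sig y -> y.1 = cA /\ lo < y.2 < hi.
Proof.
move=> /A_out[y1 /andP[h1 h2]] nS; split => //.
rewrite !lt_neqAle h1 h2 !andbT; apply/andP; split; apply/eqP => e; apply: nS; right.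
  by left; apply: plane_eq.
by right; apply: plane_eq.
Qed.

Lemma half_diskW y (i : 'I_n) k e e' : 0 < e' -> e' <= e -> half_disk y i k e -> half_disk y i k e'.
Proof.
by move=> e0 ee [h1 h2 h3 h4]; split => // p yp; apply: h4; exact: sqW yp.
Qed.

(** The half disk contains a second Andreev point, a little above [y] or a little below it; both lie
    on side [i] and have the same abscissa. *)
Lemma andreev_edge y (i : 'I_n) k e : A y -> half_disk y i k e -> (edge i).1 = 0.
Proof.
move=> Ay [si _ e0 H]; have [y1 /andP[yl yh]] := A_out Ay.
suff [dl [dl0 dle Adl]] : exists dl : R, [/\ dl != 0, `|dl| < e & A (cA, y.2 + dl)].
  have yq : sq y e (cA, y.2 + dl).
    split; rewrite /= ?y1 ?subrr ?normr0 //.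
    by rewrite addrAC subrr add0r.
  have [j sj] := (boundary_side P _).1 (andreev_boundary Adl).
  have [_ _ /(_ _ sj) ji _ _] := H _ yq; subst j.
  have := side_crossp sj si; rewrite /crossp !planeE /= -y1 subrr mulr0 subr0.
  by rewrite addrAC subrr add0r => /eqP; rewrite mulf_eq0 (negPf dl0) orbF => /eqP.
have [yh'|yh'] := ltP y.2 hi.
  have h0 : 0 < hi - y.2 by rewrite subr_gt0.
  have [dl [dl0 dle dlm]] := lt_two e0 h0.
  exists dl; split; [by rewrite gt_eqF|by rewrite gtr0_norm|].
  by apply: A_in; lra.
have h0 : 0 < y.2 - lo by have := lohi; lra.
have [dl [dl0 dle dlm]] := lt_two e0 h0.
exists (- dl); split; [by rewrite oppr_eq0 gt_eqF|by rewrite normrN gtr0_norm|].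
by apply: A_in; lra.
Qed.

Definition regular_disk y (i : 'I_n) k e := half_disk y i k e /\
  forall p, sq y e p -> boundary T p -> ~ Sig p /\ (A p <-> A y).

(** Away from the two endpoints, the Andreev set is both open and closed in the boundary; this is
    why the endpoints count as singular. *)
Lemma regular_disk_exists y : boundary T y -> ~ Sig y -> exists (i : 'I_n) k e, regular_disk y i k e.
Proof.
move=> by_ nS.
have [|i [k [e hd]]] := half_disk_exists by_.
  by move=> j yj; apply: nS; left; exists j.
have [si k1 e0 H] := hd; have u0 := edge_neq0 i.
suff [e' e'0 H'] : exists2 e', 0 < e' & forall p, sq y (Num.min e e') p -> boundary T p ->
    ~ (p = (cA, lo) \/ p = (cA, hi)) /\ (A p <-> A y).
  exists i, k, (Num.min e e'); split.
    by apply: half_diskW hd; rewrite ?ge_min ?lexx // lt_min e0.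
  move=> p yp bp; have [nc AA] := H' _ yp bp; split => // -[[j pj]|//].
  have [|_ _ _ _ /(_ j)//] := H p.
  by apply: sqW yp; rewrite ge_min lexx.
have [Ay|nAy] := pselect (A y).
  have [y1 /andP[yl yh]] := A_regular Ay nS.
  pose m := Num.min (y.2 - lo) (hi - y.2).
  have m0 : 0 < m by rewrite lt_min !subr_gt0 yl.
  have ml : m <= y.2 - lo by rewrite ge_min lexx.
  have mh : m <= hi - y.2 by rewrite ge_min lexx orbT.
  have u1 := andreev_edge Ay hd.
  have u2 : (edge i).2 != 0 by apply: contra_neq u0 => u2; exact: plane_eq.
  exists m => // p yp bp.
  have [pe pm] : sq y e p /\ sq y m p.
    by split; apply: sqW yp; rewrite ge_min lexx ?orbT.
  have [j sj] := (boundary_side P p).1 bp.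
  have [_ _ /(_ _ sj) ji _ _] := H p pe; subst j.
  have := side_crossp sj si; rewrite /crossp !planeE u1 mul0r sub0r => /eqP.
  rewrite oppr_eq0 mulf_eq0 (negPf u2) /= subr_eq0 => /eqP p1.
  have hp : lo < p.2 < hi by move: pm => [_]; rewrite ltr_norml; lra.
  have Ap : A p by have := A_in hp; rewrite -y1 -p1; case: (p).
  by split => // -[] pp; move: hp; rewrite pp /= ltxx ?andbF.
have [y1|y1] := eqVneq y.1 cA; last first.
  exists `|y.1 - cA|; first by rewrite normr_gt0 subr_eq0.
  move=> p yp bp; have pc : p.1 <> cA.
    move=> pc; have [] : sq y `|y.1 - cA| p by apply: sqW yp; rewrite ge_min lexx orbT.
    by rewrite pc distrC ltxx.
  by split; [move=> [] pp; apply: pc; rewrite pp|split => // /A_out[]].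
have [yl|yl] := ltP y.2 lo.
  exists (lo - y.2); first by rewrite subr_gt0.
  move=> p yp bp; have pc : p.2 < lo.
    have [_] : sq y (lo - y.2) p by apply: sqW yp; rewrite ge_min lexx orbT.
    by rewrite ltr_norml; lra.
  split; first by move=> [] pp; move: pc; rewrite pp /=; have := lohi; lra.
  by split => // /A_out[_ ?]; exfalso; lra.
have [yh|yh] := ltP hi y.2.
  exists (y.2 - hi); first by rewrite subr_gt0.
  move=> p yp bp; have pc : hi < p.2.
    have [_] : sq y (y.2 - hi) p by apply: sqW yp; rewrite ge_min lexx orbT.
    by rewrite ltr_norml; lra.
  split; first by move=> [] pp; move: pc; rewrite pp /=; have := lohi; lra.
  by split => // /A_out[_ ?]; exfalso; lra.
(* What is left is a point of the closed segment. It lies strictly between the endpoints, which are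
   singular. *)
exfalso; apply: nAy.
have : lo < y.2 < hi.
  rewrite !lt_neqAle yl yh !andbT; apply/andP; split; apply/eqP => e1; apply: nS; right.
    by left; apply: plane_eq.
  by right; apply: plane_eq.
by move=> /A_in; rewrite -y1; case: (y).
Qed.

Definition hit x d y := exists t, [/\ 0 < t, y = x + t *: d,
  forall s, 0 < s < t -> O (x + s *: d) & ~ O y].

Definition starts x d := exists2 s0, 0 < s0 & forall s, 0 < s < s0 -> O (x + s *: d).

(* Uniformity in the starting point is what makes [hit] stable. *)
Definition starts_near x d := exists2 e, 0 < e & exists2 s0, 0 < s0 &
  forall x', T x' -> sq x e x' -> forall s, 0 < s < s0 -> O (x' + s *: d).

Lemma hit_fun x d y y' : hit x d y -> hit x d y' -> y = y'.
Proof.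
move=> [t [t0 -> Ht nO]] [t' [t0' -> Ht' nO']]; congr (_ + _ *: _).
have [tt|tt|//] := ltrgtP t t'.
  by exfalso; apply: nO; apply: Ht'; rewrite t0.
by exfalso; apply: nO'; apply: Ht; rewrite t0'.
Qed.

Lemma hit_boundary x d y : hit x d y -> boundary T y.
Proof. by move=> [t [t0 -> Ht nO]]; exact: exit_boundary. Qed.

Lemma starts_nearW x d : T x -> starts_near x d -> starts x d.
Proof.
by move=> Tx [e e0 [s s0 H]]; exists s => //; apply: H => //; exact: sqxx.
Qed.

Lemma starts_near_interior x d : O x -> starts_near x d.
Proof.
move=> Ox; have [e e0 H] := interior_nbhs Ox.
have e20 : 0 < e / 2 by rewrite divr_gt0.
have [e' e'0 H'] := along_sq 0 d e20.
exists (e / 2) => //; exists e' => // x' _ [a b] s /andP[s0 s1]; apply: H.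
have [|c f] := H' s; first by rewrite gtr0_norm.
move: c f; rewrite !planeE /= !add0r !subr0 => c f.
by split; rewrite !planeE addrAC; apply: le_lt_trans (ler_normD _ _) _; lra.
Qed.

(** Moving along [d] strictly increases [k * crossp], which is nonnegative on the part of the table
    in the square. *)
Lemma starts_near_half_disk y d (i : 'I_n) k e : half_disk y i k e ->
  0 < k * crossp (edge i) d -> starts_near y d.
Proof.
move=> [si k1 e0 H] kd.
have e20 : 0 < e / 2 by rewrite divr_gt0.
have [e' e'0 H'] := along_sq 0 d e20.
exists (e / 2) => //; exists e' => // x' Tx' yx' s /andP[s0 s1].
have yxe : sq y e x' by apply: sqW yx'; lra.
have yp : sq y e (x' + s *: d).
  have [|c f] := H' s; first by rewrite gtr0_norm.
  move: c f yx' => + + [a b]; rewrite !planeE /= !add0r !subr0 => c f.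
  by split; rewrite !planeE addrAC; apply: le_lt_trans (ler_normD _ _) _; lra.
have [-> _ _ _ _] := H _ yp.
have [_ /iffLR/(_ Tx') h _ _ _] := H _ yxe.
rewrite addrAC crosspD crosspZ mulrDr; apply: ltr_wpDl => //.
by rewrite mulrCA mulr_gt0.
Qed.

Lemma half_disk_starts y d (i : 'I_n) k e : half_disk y i k e -> starts y d ->
  0 < k * crossp (edge i) d.
Proof.
move=> [si k1 e0 H] [s0 s00 Hs].
have [e' e'0 H'] := along_sq y d e0.
have [s [s_0 ss0 se]] := lt_two s00 e'0.
have ys : sq y e (y + s *: d) by apply: H'; rewrite gtr0_norm.
have [/iffLR + _ _ _ _] := H _ ys; have Os : O (y + s *: d) by apply: Hs; rewrite s_0.
move=> /(_ Os); rewrite addrAC subrr add0r crosspZ mulrCA.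
by rewrite pmulr_rgt0.
Qed.

Lemma hit_opp x d y : hit x d y -> starts y (- d).
Proof.
move=> [t [t0 -> H _]]; exists t => // s /andP[s0 st].
have -> : x + t *: d + s *: - d = x + (t - s) *: d.
  by apply: plane_eq; rewrite !planeE; ring.
by apply: H; lra.
Qed.

Lemma hit_half_disk x d y (i : 'I_n) k e : hit x d y -> half_disk y i k e ->
  k * crossp (edge i) d < 0.
Proof.
move=> /hit_opp h hd; have := half_disk_starts hd h.
by rewrite crosspN mulrN oppr_gt0.
Qed.

Lemma hit_bounce x d y (i : 'I_n) k e : hit x d y -> half_disk y i k e ->
  starts_near y (reflect_dir (edge i) d).
Proof.
move=> h hd; apply: (starts_near_half_disk hd); have := hit_half_disk h hd.
by rewrite crossp_reflect ?edge_neq0 // mulrN oppr_gt0.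
Qed.

Lemma hit_exists x d : d != 0 -> starts x d -> exists y, hit x d y.
Proof.
move=> d0 [s0 s00 Hs]; have [M M0 HM] := table_bounded P.
have [b bs nOb] : exists2 b, s0 / 2 <= b & ~ O (x + b *: d).
  apply: contrapT => H.
  have {}H b : s0 / 2 <= b -> `|(x + b *: d).1| <= M /\ `|(x + b *: d).2| <= M.
    move=> hb; apply: HM; apply: interiorT; apply: contrapT => nO.
    by apply: H; exists b.
  have key (a c : R) : c != 0 -> (forall b : R, s0 / 2 <= b -> `|a + b * c| <= M) -> False.
    (* From a coordinate bounded by [M], a displacement of [3 * M] leads out of the table. *)
    move=> c0 Hb; pose b := s0 / 2 + 3 * M / `|c|.
    have h1 : `|a + s0 / 2 * c| <= M by apply: Hb.
    have c0' : 0 < `|c| by rewrite normr_gt0.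
    have : `|a + b * c| <= M by apply: Hb; rewrite lerDl divr_ge0 // mulr_ge0 // ltW.
    have -> : a + b * c = (3 * M / `|c| * c) + (a + s0 / 2 * c) by rewrite /b; ring.
    have := lerB_normD (3 * M / `|c| * c) (a + s0 / 2 * c).
    have -> : `|3 * M / `|c| * c| = 3 * M.
      by rewrite normrM gtr0_norm ?divr_gt0 ?mulr_gt0 // divfK ?gt_eqF.
    by have := M0; lra.
  have [d1|d1] := eqVneq d.1 0; last first.
    by apply: (key x.1 d.1) => // b /H[].
  apply: (key x.2 d.2) => [|b /H[]//].
  by apply: contra_neq d0 => d2; exact: plane_eq.
have [t /andP[t0 tb] [Ht nOt]] := first_exit bs nOb.
exists (x + t *: d), t; split => //; first by apply: lt_le_trans t0; rewrite divr_gt0.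
move=> s /andP[s_0 st]; have [ss|ss] := ltP s s0; first by apply: Hs; rewrite s_0.
by apply: Ht; rewrite st andbT; lra.
Qed.
End dynamics.

(** * Dependence of a flight on its starting point *)

Section stability.
Variables (R : realType) (P : andreev_billiard R).
Local Notation plane := (R * R)%type.
Implicit Types p q u d x y : plane.
Local Notation T := (table P).
Local Notation O := (table P)°.
Local Notation n := (nsides P).
Local Notation hit := (hit P).
Local Notation starts_near := (starts_near P).

Lemma sq_trans x y e e' p : sq x e y -> sq y e' p -> sq x (e + e') p.
Proof.
move=> [a b] [c d]; split.
  by rewrite -(subrKA y.1); apply: le_lt_trans (ler_normD _ _) _; rewrite addrC ltrD.
by rewrite -(subrKA y.2); apply: le_lt_trans (ler_normD _ _) _; rewrite addrC ltrD.
Qed.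

Lemma sqD x e p q : sq x e p -> sq (x + q) e (p + q).
Proof. by move=> [a b]; split; rewrite !planeE opprD addrACA subrr addr0. Qed.

Lemma tube_local x d s : O (x + s *: d) -> exists2 c, 0 < c & exists2 e, 0 < e &
  forall s', `|s' - s| < c -> forall p, sq (x + s' *: d) e p -> O p.
Proof.
move=> /interior_nbhs[e e0 H].
have e20 : 0 < e / 2 by rewrite divr_gt0.
have [c c0 H'] := along_sq (x + s *: d) d e20.
exists c => //; exists (e / 2) => // s' /H' h p yp; apply: H.
have e_ : x + s *: d + (s' - s) *: d = x + s' *: d.
  by apply: plane_eq; rewrite !planeE; ring.
rewrite -e_ in yp; have := sq_trans h yp; apply: sqW; lra.
Qed.

(** Compactness of the segment, as an induction over its end time: [Q t] is the uniform radius up to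
    time [t], guarded so that nothing is asked after [b]. *)
Lemma tube x d (a b : R) : a <= b -> (forall s, a <= s <= b -> O (x + s *: d)) ->
  exists2 e, 0 < e & forall s, a <= s <= b -> forall p, sq (x + s *: d) e p -> O p.
Proof.
move=> ab H.
pose Q (t : R) := t <= b -> exists2 e, 0 < e & forall s, a <= s <= t -> forall p, sq (x + s *: d) e p -> O p.
have extend t c e (s : R) : 0 < e ->
  (forall s', `|s' - t| < c -> forall p, sq (x + s' *: d) e p -> O p) ->
  (exists2 e, 0 < e & forall s', a <= s' <= s -> forall p, sq (x + s' *: d) e p -> O p) ->
  t - c < s -> forall t', t' < t + c ->
  exists2 e, 0 < e & forall s', a <= s' <= t' -> forall p, sq (x + s' *: d) e p -> O p.
  move=> e0 He [e1 e10 He1] ts t' tt'; have [m [m0 me me1]] := lt_two e0 e10.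
  exists m => // s' hs' p xp; have [ss|ss] := leP s' s.
    by apply: (He1 s'); [lra|apply: sqW xp; exact: ltW].
  by apply: (He s'); [rewrite ltr_norml; lra|apply: sqW xp; exact: ltW].
apply: contrapT => nQ.
have [|s as_ Qs|t /andP[at_ tb] [Ht nQt]] := @first_time R Q a b ab.
- by move=> /(_ (lexx b)).
- have [sb|sb] := ltP b s.
    exists 1; first by lra.
    by move=> s' hs' s'b; lra.
  have [c c0 [e e0 He]] := tube_local (H s ltac:(lra)).
  exists c => // s' hs' s'b; apply: (extend s c e s) => //; [exact: Qs|lra|lra].
- have [c c0 [e e0 He]] := tube_local (H t ltac:(lra)).
  apply: nQt => _.
  have [tc|tc] := ltP a (t - c / 2).
    by apply: (extend t c e (t - c / 2)) => //; [apply: Ht; lra|lra|lra].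
  exists e => // s hs; apply: He; rewrite ltr_norml; lra.
Qed.

(** The beginning of the flight is controlled by [starts_near], its middle by a tube, and its end by
    the half disk, where the collision time solves a linear equation. *)
Lemma hit_stable x d y (i : 'I_n) k e eta : starts_near x d -> hit x d y ->
  half_disk y i k e -> 0 < eta ->
  exists2 e', 0 < e' & forall x', T x' -> sq x e' x' ->
    exists2 y', hit x' d y' & sq y eta y' /\ side (vertex P) i y'.
Proof.
move=> [es es0 [s0 s00 Hs]] hxy hd eta0.
have kc := hit_half_disk hxy hd.
have [t [t0 yE Ht nOy]] := hxy; have [si k1 e0 H] := hd.
set u := edge i in kc H *; set c := crossp u d in kc *.
have c0 : c != 0 by apply: contraTneq kc => ->; rewrite mulr0 ltxx.
have [h2 [h20 h2eta h2e]] := lt_two eta0 e0.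
pose h := h2 / 2; have h0 : 0 < h by rewrite divr_gt0.
have [dl0 dl00 Hdl] := along_sq y d h0.
have [dl [dlp dldl dlt]] := lt_two dl00 t0.
have t20 : 0 < t / 2 by rewrite divr_gt0.
have [a [a0 as0 at2]] := lt_two s00 t20.
have [|s hs|e1 e10 He1] := @tube x d a (t - dl / 2).
- by lra.
- by apply: Ht; lra.
have cd0 : 0 < `|c| * (dl / 2) by rewrite mulr_gt0 ?normr_gt0 // divr_gt0.
have [e2 e20 He2] := crossp_cont u x cd0.
have [m1 [m10 m1e1 m1e2]] := lt_two e10 e20.
have [m2 [m20 m2h m2s]] := lt_two h0 es0.
have [e' [e'0 e'1 e'2]] := lt_two m10 m20.
exists e' => // x' Tx' xx'.
(* Starting from [x'], the line of the side is reached at time [t - g]; this is what [cE]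
   expresses. *)
pose g := crossp u (x' - x) / c.
have gd : `|g| < dl / 2.
  rewrite normrM normfV ltr_pdivrMr ?normr_gt0 // mulrC; apply: He2.
  by apply: sqW xx'; lra.
have cE s : crossp u (x' + s *: d - y) = (s - (t - g)) * c.
  have -> : x' + s *: d - y = (x' - x) + (s - t) *: d.
    by rewrite yE; apply: plane_eq; rewrite !planeE; ring.
  have gE : g * c = crossp u (x' - x) by rewrite /g divfK.
  by rewrite crosspD crosspZ -/c -gE; ring.
have near s : `|s - t| < dl -> sq y h2 (x' + s *: d).
  move=> hs; have xh : sq x h x' by apply: sqW xx'; lra.
  have -> : h2 = h + h by rewrite /h; lra.
  have := sqD (y - x + (s - t) *: d) xh.
  have -> : x + (y - x + (s - t) *: d) = y + (s - t) *: d.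
    by apply: plane_eq; rewrite !planeE; ring.
  have -> : x' + (y - x + (s - t) *: d) = x' + s *: d.
    by rewrite yE; apply: plane_eq; rewrite !planeE; ring.
  by apply: sq_trans; apply: Hdl; lra.
move: (gd); rewrite ltr_norml => /andP[gd1 gd2].
have neary : sq y h2 (x' + (t - g) *: d) by apply: near; rewrite ltr_norml; lra.
have [yO _ _ yside _] := H _ (sqW (ltW h2e) neary).
have cy : crossp u (x' + (t - g) *: d - y) = 0 by rewrite cE subrr mul0r.
exists (x' + (t - g) *: d); last first.
  by split; [apply: sqW neary; exact: ltW|exact: yside].
exists (t - g); split => //; first lra.
- move=> s /andP[s_0 st].
  have [ss|ss] := ltP s s0; first by apply: Hs => //; [apply: sqW xx'; lra|rewrite s_0].
  have [st'|st'] := leP s (t - dl / 2).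
    apply: (He1 s); first lra.
    by apply: sqD; apply: sqW xx'; lra.
  have nrs : sq y h2 (x' + s *: d) by apply: near; rewrite ltr_norml; lra.
  have [-> _ _ _ _] := H _ (sqW (ltW h2e) nrs).
  rewrite cE mulrCA nmulr_rgt0 ?subr_lt0 //; exact: st.
- by move=> /yO; rewrite cy mulr0 ltxx.
Qed.

Lemma hit_rev x d y : hit x d y -> ~ O x -> hit y (- d) x.
Proof.
move=> [t [t0 -> H _]] nOx; exists t; split => //.
  by apply: plane_eq; rewrite !planeE; ring.
move=> s hs.
have -> : x + t *: d + s *: - d = x + (t - s) *: d.
  by apply: plane_eq; rewrite !planeE; ring.
by apply: H; lra.
Qed.

Lemma hit_through x d y z : O x -> hit x (- d) z -> hit x d y -> hit z d y.
Proof.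
move=> Ox [t [t0 -> H _]] [t' [t'0 -> H' nO']]; exists (t + t'); split => //.
- exact: addr_gt0.
- by apply: plane_eq; rewrite !planeE; ring.
move=> s /andP[s0 st].
have [ss|ss|->] := ltrgtP s t.
- have -> : x + t *: - d + s *: d = x + (t - s) *: - d.
    by apply: plane_eq; rewrite !planeE; ring.
  by apply: H; lra.
- have -> : x + t *: - d + s *: d = x + (s - t) *: d.
    by apply: plane_eq; rewrite !planeE; ring.
  by apply: H'; lra.
- suff -> : x + t *: - d + t *: d = x by [].
  by apply: plane_eq; rewrite !planeE; ring.
Qed.

Lemma hit_back x x' d y : hit x d y -> hit x' d y -> ~ O x -> ~ O x' -> x = x'.
Proof. by move=> /hit_rev h /hit_rev h' /h a /h' b; exact: hit_fun a b. Qed.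
End stability.

(** * Itineraries and the orbits that follow them *)

Section bounces.
Variables (R : realType) (P : andreev_billiard R) (cA lo hi : R).
Local Notation plane := (R * R)%type.
Implicit Types p q u d x y : plane.
Local Notation T := (table P).
Local Notation O := (table P)°.
Local Notation A := (andreev P).
Local Notation n := (nsides P).
Local Notation hit := (hit P).
Local Notation starts := (starts P).
Local Notation starts_near := (starts_near P).
Local Notation Sig := (singular_point P cA lo hi).
Local Notation rfl i := (reflect_dir (@edge _ P i)).
Implicit Types w v : seq 'I_n.

Hypothesis lohi : lo < hi.
Hypothesis A_in : forall y : R, lo < y < hi -> A (cA, y).
Hypothesis A_out : forall p, A p -> p.1 = cA /\ lo <= p.2 <= hi.

Definition turn w d := foldl (fun d i => rfl i d) d w.

(** Orbits of the ordinary billiard in the folded table, recorded by the sides they hit. Each bounce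
    is at a regular point outside the Andreev set, so an orbit without long itineraries soon meets a
    singular or an Andreev point. *)
Fixpoint bounces w x d y : Prop :=
  if w is i :: w' then exists2 z, hit x d z &
    [/\ ~ Sig z, ~ A z, side (vertex P) i z & bounces w' z (rfl i d) y]
  else y = x.

Lemma nonvertex y : ~ Sig y -> forall i, y <> vertex P i.
Proof. by move=> nS i yi; apply: nS; left; exists i. Qed.

Lemma turn_cat w v d : turn (w ++ v) d = turn v (turn w d).
Proof. by rewrite /turn foldl_cat. Qed.
Lemma turn_rcons w i d : turn (rcons w i) d = rfl i (turn w d).
Proof. by rewrite -cats1 turn_cat. Qed.
Lemma turnN w d : turn w (- d) = - turn w d.
Proof. by elim: w d => //= i w IH d; rewrite reflect_dirN IH. Qed.
Lemma turn_rev w d : turn (rev w) (turn w d) = d.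
Proof.
elim: w d => //= i w IH d.
by rewrite rev_cons turn_rcons IH reflect_dirK // edge_neq0.
Qed.
Lemma turn0 w : turn w 0 = 0.
Proof.
elim: w => //= i w IH; suff -> : rfl i 0 = 0 by [].
by rewrite /reflect_dir /dotp; apply: plane_eq; rewrite !planeE /=; ring.
Qed.
Lemma bounces_cat w v x d y :
  bounces (w ++ v) x d y <-> exists2 z, bounces w x d z & bounces v z (turn w d) y.
Proof.
elim: w x d => [|i w IH] x d /=; first by split; [exists x|move=> [z ->]].
split.
  by move=> [z hz [h1 h2 h3 /IH[z' h4 h5]]]; exists z' => //; exists z.
by move=> [z' [z hz [h1 h2 h3 h4]] h5]; exists z => //; split => //; apply/IH; exists z'.
Qed.

Lemma bounces_rcons w i x d y : bounces (rcons w i) x d y <->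
  exists2 z, bounces w x d z & [/\ hit z (turn w d) y, ~ Sig y, ~ A y & side (vertex P) i y].
Proof.
rewrite -cats1; split=> [/bounces_cat[z hz /= [z' h [h1 h2 h3 ->]]]|].
  by exists z.
by move=> [z hz [h1 h2 h3 h4]]; apply/bounces_cat; exists z => //=; exists y.
Qed.

Lemma bounces_fun w x d y y' : bounces w x d y -> bounces w x d y' -> y = y'.
Proof.
elim: w x d => [|i w IH] x d /=; first by move=> -> ->.
move=> [z hz [_ _ _ b]] [z' hz' [_ _ _ b']].
by rewrite (hit_fun hz' hz) in b'; exact: IH b b'.
Qed.

Lemma bounces_word w w' x d y y' : size w = size w' ->
  bounces w x d y -> bounces w' x d y' -> w = w'.
Proof.
elim: w w' x d => [[]//|i w IH [//|i' w'] x d /= [ss]].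
move=> [z hz [n1 _ si b]] [z' hz' [_ _ si' b']].
rewrite (hit_fun hz' hz) in si' b'.
have ii := side_inj si si' (nonvertex n1); subst i'.
by congr cons; exact: IH ss b b'.
Qed.

Lemma bounces_starts_near w x d y : starts_near x d -> bounces w x d y -> starts_near y (turn w d).
Proof.
elim: w x d => [|i w IH] x d /= sx; first by move=> ->.
move=> [z hz [nS _ si b]]; apply: IH b.
have [j [k [e [hd _]]]] := regular_disk_exists lohi A_in A_out (hit_boundary hz) nS.
have [sj _ _ _] := hd; have ij := side_inj si sj (nonvertex nS); subst j.
exact: hit_bounce hz hd.
Qed.

Lemma side_boundary i y : side (vertex P) i y -> boundary T y.
Proof. by move=> si; apply/boundary_side; exists i. Qed.

Lemma side_table i y : side (vertex P) i y -> T y.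
Proof. by move=> /side_boundary/boundaryE[]. Qed.

Lemma hit_stable_regular x d y i eta : starts_near x d -> hit x d y -> ~ Sig y ->
  side (vertex P) i y -> 0 < eta ->
  exists2 e, 0 < e & forall x', T x' -> sq x e x' ->
    exists2 y', hit x' d y' & [/\ sq y eta y', ~ Sig y', A y' <-> A y & side (vertex P) i y'].
Proof.
move=> sx hy nS si eta0.
have [j [k [e [hd Hd]]]] := regular_disk_exists lohi A_in A_out (hit_boundary hy) nS.
have [sj _ e0 _] := hd; have ij := side_inj si sj (nonvertex nS); subst j.
have [m [m0 me meta]] := lt_two e0 eta0.
have [e' e'0 H] := hit_stable sx hy hd m0.
exists e' => // x' Tx' xx'; have [y' hy' [yy' si']] := H x' Tx' xx'.
exists y' => //.
have [|nS' AA] := Hd y' _ (side_boundary si'); first by apply: sqW yy'; exact: ltW.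
by split => //; apply: sqW yy'; exact: ltW.
Qed.

Lemma bounces_stable w x d y eta : T x -> starts_near x d -> bounces w x d y -> 0 < eta ->
  exists2 e, 0 < e & forall x', T x' -> sq x e x' ->
    exists2 y', bounces w x' d y' & sq y eta y' /\ T y'.
Proof.
move=> Tx sx + eta0.
elim: w x d Tx sx => [|i w IH] x d Tx sx /=.
  by move=> ->; exists eta => // x' Tx' xx'; exists x'.
move=> [z hz [nS nA si b]].
have sz : starts_near z (rfl i d).
  by apply: (@bounces_starts_near [:: i] x d z sx); exists z.
have [e1 e10 H1] := IH _ _ (side_table si) sz b.
have [e e0 H] := hit_stable_regular sx hz nS si e10.
exists e => // x' Tx' xx'; have [z' hz' [zz' nS' AA si']] := H x' Tx' xx'.
have [y' b' yy'] := H1 z' (side_table si') zz'.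
by exists y' => //; exists z' => //; split => //; rewrite AA.
Qed.

Lemma crossp_reflect_side i d p q : side (vertex P) i p -> side (vertex P) i q ->
  crossp (rfl i d) (q - p) = - crossp d (q - p).
Proof.
move=> sp sq_; have := side_crossp sq_ sp => /(crossp_eq0 (edge_neq0 i)) ->.
rewrite !crosspZ [crossp (rfl i d) _]crosspC crossp_reflect ?edge_neq0 //.
by rewrite [crossp d _]crosspC; ring.
Qed.

Lemma hit_crossp x x' d y y' : hit x d y -> hit x' d y' ->
  crossp d (y' - y) = crossp d (x' - x).
Proof.
move=> [t [_ -> _ _]] [t' [_ -> _ _]].
have -> : x' + t' *: d - (x + t *: d) = x' - x + (t' - t) *: d.
  by apply: plane_eq; rewrite !planeE; ring.
by rewrite crosspD crosspZ crosspp mulr0 addr0.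
Qed.

(* The transverse measure is invariant. *)
Lemma bounces_crossp w x x' d y y' : bounces w x d y -> bounces w x' d y' ->
  crossp (turn w d) (y' - y) = (-1) ^+ size w * crossp d (x' - x).
Proof.
elim: w x x' d => [|i w IH] x x' d /=; first by move=> -> ->; rewrite expr0 mul1r.
move=> [z hz [_ _ si b]] [z' hz' [_ _ si' b']].
rewrite (IH _ _ _ b b') crossp_reflect_side // (hit_crossp hz hz') exprS.
by rewrite mulN1r mulrN mulNr.
Qed.

Lemma bounces_rev w x d y a : bounces w x d y -> hit y (turn w d) a ->
  exists2 z, hit x d z & bounces (rev w) a (- turn w d) z.
Proof.
elim: w x d => [|i w IH] x d /=; first by move=> ->; exists a.
move=> [z hz [nS nA si b]] hy; have [z' hz' b'] := IH _ _ b hy.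
exists z => //; rewrite rev_cons; apply/bounces_rcons; exists z' => //.
rewrite -turnN turn_rev; split => //; apply: hit_rev hz' _.
by have /boundaryE[] := hit_boundary hz.
Qed.

(** Traced back from the same point and direction, both orbits run through the same sides. Neither
    can stop before the other, since it stops at an Andreev point, where [bounces] does not allow a
    bounce. *)
Lemma bounces_inj w w' a b d d' q : A a -> A b ->
  bounces w a d q -> bounces w' b d' q -> turn w d = turn w' d' -> a = b /\ w = w'.
Proof.
move=> Aa Ab.
elim/last_ind: w w' q => [|w i IH] w' q.
  case/lastP: w' => [|w' i] /=; first by move=> -> ->.
  by move=> -> /bounces_rcons[z _ [_ _ /(_ Aa)]].
move=> /bounces_rcons[z bz [hz nS nA si]].
case/lastP: w' => [/= qb|w' i' /bounces_rcons[z' bz' [hz' _ _ si']]].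
  by case: nA; rewrite qb.
have ii := side_inj si si' (nonvertex nS); subst i'.
rewrite !turn_rcons => /(congr1 (rfl i)); rewrite !reflect_dirK ?edge_neq0 // => tt.
have nO v c e p : A c -> bounces v c e p -> ~ O p.
  move=> Ac; case/lastP: v => [/= ->|v j /bounces_rcons[? _ [_ _ _ /side_boundary]]].
    by have /boundaryE[] := andreev_boundary Ac.
  by move=> /boundaryE[].
rewrite -tt in hz'.
have zz := hit_back hz hz' (nO _ _ _ _ Aa bz) (nO _ _ _ _ Ab bz'); subst z'.
by have [-> ->] := IH _ _ bz bz' tt.
Qed.

Definition free m x d := exists w y, size w = m /\ bounces w x d y.
Definition strikes m x d := exists w y a,
  [/\ size w = m, bounces w x d y, hit y (turn w d) a, A a & ~ Sig a].
Definition ends m x d := exists w y a,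
  [/\ size w = m, bounces w x d y, hit y (turn w d) a & Sig a].

(** Each further flight ends at a singular point, in the Andreev set, or at an ordinary wall; only
    in the last case does the itinerary grow. *)
Lemma free_or x d m : d != 0 -> starts_near x d -> T x ->
  free m x d \/ exists2 k, (k < m)%N & strikes k x d \/ ends k x d.
Proof.
move=> d0 sx Tx; elim: m => [|m [[w [y [sw b]]]|[k km H]]]; first by left; exists [::], x.
  have sy := bounces_starts_near sx b.
  have Ty : T y.
    by move: b; case/lastP: (w) => [/= ->//|v j /bounces_rcons[? _ [_ _ _ /side_table]]].
  have t0 : turn w d != 0.
    by apply: contra_neq d0 => t0; rewrite -(turn_rev w d) t0 turn0.
  have [z hz] := hit_exists t0 (starts_nearW Ty sy).
  have [Sz|nSz] := pselect (Sig z).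
    by right; exists m => //; right; exists w, y, z.
  have [Az|nAz] := pselect (A z).
    by right; exists m => //; left; exists w, y, z.
  have [i si] := (boundary_side P _).1 (hit_boundary hz).
  left; exists (rcons w i), z; rewrite size_rcons sw; split => //.
  by apply/bounces_rcons; exists y.
by right; exists k => //; exact: ltnW.
Qed.

Lemma free_le m m' x d : (m' <= m)%N -> free m x d -> free m' x d.
Proof.
move=> mm [w [y [sw]]]; rewrite -{1}(cat_take_drop m' w) => /bounces_cat[z bz _].
by exists (take m' w), z; rewrite size_takel // sw.
Qed.

Lemma free_strikes m k x d : free m x d -> (k < m)%N -> ~ strikes k x d.
Proof.
move=> [w [y [sw]]] + km [v [z [a [sv bv hz Aa nSa]]]].
rewrite -(cat_take_drop k w) => /bounces_cat[z' bz'].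
have sk : size (take k w) = size v by rewrite size_takel ?sv // sw ltnW.
have vk := bounces_word sk bz' bv; rewrite vk in bz' *.
rewrite (bounces_fun bz' bv).
have : (0 < size (drop k w))%N by rewrite size_drop sw subn_gt0.
case: drop => //= i v' _ [z'' hz'' [_ nA _ _]].
by apply: nA; rewrite (hit_fun hz'' hz).
Qed.

Lemma free_stable m x d : T x -> starts_near x d -> free m x d ->
  exists2 e, 0 < e & forall x', T x' -> sq x e x' -> free m x' d.
Proof.
move=> Tx sx [w [y [sw b]]]; have [e e0 H] := bounces_stable Tx sx b (@ltr01 R).
by exists e => // x' Tx' /(H _ Tx')[y' b' _]; exists w, y'.
Qed.

Lemma strikes_stable m x d : T x -> starts_near x d -> strikes m x d ->
  exists2 e, 0 < e & forall x', T x' -> sq x e x' -> strikes m x' d.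
Proof.
move=> Tx sx [w [y [a [sw b ha Aa nSa]]]].
have [i si] := (boundary_side P _).1 (hit_boundary ha).
have [e1 e10 H1] := hit_stable_regular (bounces_starts_near sx b) ha nSa si (@ltr01 R).
have [e e0 H] := bounces_stable Tx sx b e10.
exists e => // x' Tx' /(H _ Tx')[y' b' [yy' Ty']].
have [a' ha' [_ nS' AA _]] := H1 y' Ty' yy'.
by exists w, y', a'; split => //; rewrite AA.
Qed.

(** Reversing a strike gives an orbit that leaves the Andreev set and passes through [x] after [m]
    bounces, so statements about orbits leaving the segment apply to [x]. *)
Lemma strikes_rev m x d : O x -> strikes m x (- d) ->
  exists a d', [/\ A a, ~ Sig a, starts a d', (exists w, d' = turn w d) &
    forall m', free m' x d -> free (m + m') a d'].
Proof.
move=> Ox [w [y [a [sw b ha Aa nSa]]]].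
have [z hz bz] := bounces_rev b ha.
exists a, (turn w d); split => //.
- by have := hit_opp ha; rewrite turnN opprK.
- by exists w.
move=> m' [v [y' [sv b']]].
rewrite turnN opprK in bz.
(* As [x] is interior, the flight that arrives at it and the first flight of [v] form a single one.
   For empty [v] there is nothing to join. *)
case: v sv b' => [|i v] /= sv b'.
  by exists (rev w), z; rewrite size_rev sw -sv addn0.
exists (rev w ++ i :: v), y'; rewrite size_cat size_rev sw -sv; split => //.
apply/bounces_cat; exists z => //; rewrite turn_rev /=.
by case: b' => z' hz' h; exists z' => //; exact: hit_through Ox hz hz'.
Qed.
End bounces.

(** * Return to the Andreev segment *)

(** The bound [dl] is uniform in [y]; it is the width that feeds the pigeonhole argument. A new
    point of the list inside the interval splits it in two, and the smaller of the two bounds is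
    kept. *)
Lemma gaps (R : realType) (s : seq R) (lo hi : R) : lo < hi -> exists2 dl, 0 < dl &
  forall y, lo < y < hi -> y \notin s -> exists l r,
    [/\ lo <= l, r <= hi, l < y < r, dl <= r - l & forall z, l < z < r -> z \notin s].
Proof.
elim: s lo hi => [|x s IH] lo hi lohi.
  by exists (hi - lo); [lra|move=> y hy _; exists lo, hi; split].
have [/andP[lx xh]|nx] := boolP (lo < x < hi); last first.
  have [dl dl0 H] := IH _ _ lohi; exists dl => // y hy.
  rewrite inE negb_or => /andP[yx /(H _ hy)[l [r [ll rh lyr dlr Hs]]]].
  exists l, r; split => // z hz; rewrite inE negb_or Hs // andbT.
  by apply: contraNneq nx => <-; lra.
have [dl1 dl10 H1] := IH _ _ lx; have [dl2 dl20 H2] := IH _ _ xh.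
exists (Num.min dl1 dl2); first by rewrite lt_min dl10.
have m1 : Num.min dl1 dl2 <= dl1 by rewrite ge_min lexx.
have m2 : Num.min dl1 dl2 <= dl2 by rewrite ge_min lexx orbT.
move=> y hy; rewrite inE negb_or => /andP[yx ys].
have [yx'|xy'|/eqP] := ltrgtP y x; last by rewrite (negPf yx).
  have [|l [r [ll rh lyr dlr Hs]]] := H1 y _ ys; first by lra.
  exists l, r; split => //; [lra|lra|move=> z hz].
  by rewrite inE negb_or Hs // andbT; apply/eqP => zx; lra.
have [|l [r [ll rh lyr dlr Hs]]] := H2 y _ ys; first by lra.
exists l, r; split => //; [lra|lra|move=> z hz].
by rewrite inE negb_or Hs // andbT; apply/eqP => zx; lra.
Qed.

Lemma interval_notin (R : realType) (s : seq R) (lo hi : R) : lo < hi ->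
  exists2 y, lo < y < hi & y \notin s.
Proof.
elim: s lo hi => [|x s IH] lo hi lohi; first by exists ((lo + hi) / 2); [lra|].
have [hx|hx] := boolP (lo < x < hi).
  have [|y hy ys] := IH lo x; first by lra.
  by exists y; [lra|rewrite inE negb_or ys andbT; apply/eqP => yx; lra].
have [y hy ys] := IH _ _ lohi; exists y => //.
by rewrite inE negb_or ys andbT; apply: contraNneq hx => <-.
Qed.

(** Connectedness of an interval. Points to the left of [y0] are treated by the change of variable
    [y] to [- y]. *)
Lemma interval_const (R : realType) (Q : R -> Prop) (l r y0 : R) : l < y0 < r -> Q y0 ->
  (forall y, l < y < r -> Q y -> exists2 e, 0 < e & forall y', `|y' - y| < e -> Q y') ->
  (forall y, l < y < r -> ~ Q y -> exists2 e, 0 < e & forall y', `|y' - y| < e -> ~ Q y') ->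
  forall y, l < y < r -> Q y.
Proof.
have right (Q' : R -> Prop) (l' r' z0 : R) : l' < z0 < r' -> Q' z0 ->
    (forall y, l' < y < r' -> Q' y -> exists2 e, 0 < e & forall y', `|y' - y| < e -> Q' y') ->
    (forall y, l' < y < r' -> ~ Q' y -> exists2 e, 0 < e & forall y', `|y' - y| < e -> ~ Q' y') ->
    forall y, z0 <= y < r' -> Q' y.
  move=> hz Qz Qo Qc y /andP[zy yr]; apply: contrapT => nQ.
  pose Q2 t := t <= y -> Q' t.
  have [||t /andP[zt ty] [Ht nQt]] := @first_time R Q2 z0 y zy.
  - by move=> /(_ (lexx _)).
  - move=> s zs Qs; have [ys|sy] := ltP y s.
      by exists 1 => // s' hs' s'y; exfalso; lra.
    have [|e e0 He] := Qo s _ (Qs sy); first by lra.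
    by exists e => // s' hs' _; apply: He; rewrite ltr_norml; lra.
  - have nQt' : ~ Q' t by move=> Qt; apply: nQt.
    have [|e e0 He] := Qc t _ nQt'; first by lra.
    have zt' : z0 < t by rewrite lt_neqAle zt andbT; apply/eqP => zt'; apply: nQt'; rewrite -zt'.
    have d0 : 0 < t - z0 by rewrite subr_gt0.
    have [s [s0 se sz]] := lt_two e0 d0.
    apply: (He (t - s)); first by rewrite ltr_norml; lra.
    by apply: Ht; lra.
move=> hy0 Q0 Qo Qc y /andP[ly yr].
have [y0y|yy0] := leP y0 y; first by apply: (right Q l r y0) => //; rewrite y0y.
rewrite -(opprK y); apply: (right (fun t => Q (- t)) (- r) (- l) (- y0)).
- by lra.
- by rewrite opprK.
- move=> t ht Qt; have [|e e0 He] := Qo _ _ Qt; first by lra.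
  by exists e => // t' ht'; apply: He; rewrite -opprD normrN.
- move=> t ht Qt; have [|e e0 He] := Qc _ _ Qt; first by lra.
  by exists e => // t' ht'; apply: He; rewrite -opprD normrN.
- by lra.
Qed.

(** The image of a finite set under a partial function, given as a relation, is finite; finiteness
    is expressed by membership in a list. *)
Lemma seq_functional (X Y : choiceType) (s : seq X) (G : X -> Y -> Prop) :
  (forall x y y', G x y -> G x y' -> y = y') ->
  exists t : seq Y, forall x y, x \in s -> G x y -> y \in t.
Proof.
move=> fG; elim: s => [|x s [t IH]]; first by exists [::].
have [[y Gy]|nG] := pselect (exists y, G x y).
  exists (y :: t) => x' y'; rewrite !inE => /orP[/eqP ->|xs] G'; first by rewrite (fG _ _ _ Gy G') eqxx.
  by rewrite (IH x') ?orbT.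
exists t => x' y'; rewrite inE => /orP[/eqP ->|xs] G'; last exact: (IH x').
by exfalso; apply: nG; exists y'.
Qed.

Section return_bound.
Variables (R : realType) (P : andreev_billiard R) (cA lo hi : R).
Local Notation plane := (R * R)%type.
Implicit Types p q u d x : plane.
Local Notation T := (table P).
Local Notation O := (table P)°.
Local Notation A := (andreev P).
Local Notation n := (nsides P).
Local Notation hit := (hit P).
Local Notation starts := (starts P).
Local Notation starts_near := (starts_near P).
Local Notation Sig := (singular_point P cA lo hi).
Local Notation rfl i := (reflect_dir (@edge _ P i)).
Local Notation bounces := (@bounces _ P cA lo hi).
Local Notation turn := (@turn _ P).
Local Notation free := (free P cA lo hi).
Local Notation ends := (ends P cA lo hi).
Implicit Types w v : seq 'I_n.

Hypothesis lohi : lo < hi.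
Hypothesis A_in : forall y : R, lo < y < hi -> A (cA, y).
Hypothesis A_out : forall p, A p -> p.1 = cA /\ lo <= p.2 <= hi.

Lemma span_regular (y : R) : lo < y < hi -> ~ Sig (cA, y).
Proof.
move=> hy [[i yi]|[[yl]|[yh]]]; last 2 first.
- by move: hy; rewrite yl ltxx.
- by move: hy; rewrite yh ltxx andbF.
by apply: (@andreev_vertex _ P i); rewrite -yi; exact: A_in.
Qed.

Lemma span_table (y : R) : lo < y < hi -> T (cA, y).
Proof. by move=> /A_in/andreev_boundary/boundaryE[]. Qed.

Lemma span_half_disk (y : R) : lo < y < hi ->
  exists (i : 'I_n) k e, half_disk (cA, y) i k e /\ (edge i).1 = 0.
Proof.
move=> hy; have Ay := A_in hy; have nS := span_regular hy.
have [i [k [e [hd _]]]] := regular_disk_exists lohi A_in A_out (andreev_boundary Ay) nS.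
by exists i, k, e; split => //; exact: (andreev_edge lohi A_in A_out Ay hd).
Qed.

Lemma sq_vert (y y' e : R) : `|y' - y| < e -> sq (cA, y) e (cA, y').
Proof. by move=> h; split => //=; rewrite subrr normr0 (le_lt_trans _ h). Qed.

Lemma span_starts_fst (y : R) d : lo < y < hi -> starts (cA, y) d -> d.1 != 0.
Proof.
move=> hy sd; have [i [k [e [hd u1]]]] := span_half_disk hy.
have := half_disk_starts hd sd; rewrite /crossp u1 mul0r sub0r.
by apply: contraTneq => ->; rewrite mulr0 oppr0 mulr0 ltxx.
Qed.

(** The half disks at different points could a priori lie on different sides of the segment. As [d]
    is not vertical, [d] or [- d] points inwards at each point, and both conditions are open, so
    connectedness decides. *)
Lemma span_starts (y0 : R) d : lo < y0 < hi -> starts (cA, y0) d ->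
  forall y : R, lo < y < hi -> starts_near (cA, y) d.
Proof.
move=> hy0 s0 y hy; have d1 := span_starts_fst hy0 s0.
have near (z : R) e : lo < z < hi -> starts (cA, z) e -> starts_near (cA, z) e.
  move=> hz sz; have [i [k [r [hd _]]]] := span_half_disk hz.
  exact: (starts_near_half_disk hd (half_disk_starts hd sz)).
have nbr (z : R) e : lo < z < hi -> starts_near (cA, z) e ->
    exists2 r, 0 < r & forall z' : R, `|z' - z| < r -> lo < z' < hi -> starts (cA, z') e.
  move=> hz [r r0 [c c0 H]]; exists r => // z' hz' hz''; exists c => //.
  by apply: H; [exact: span_table|exact: sq_vert].
apply: (near y d) => //.
have inside (z : R) : lo < z < hi -> exists2 r, 0 < r & forall z' : R, `|z' - z| < r -> lo < z' < hi.
  move=> /andP[lz zh].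
  have [r [r0 r1 r2]] : exists r, [/\ 0 < r, r < z - lo & r < hi - z].
    by apply: lt_two; rewrite subr_gt0.
  by exists r => // z'; rewrite ltr_norml; lra.
apply: (@interval_const R (fun y => starts (cA, y) d) lo hi y0) => //.
- move=> z hz sz; have [r r0 Hr] := nbr _ _ hz (near _ _ hz sz).
  have [r' r'0 Hr'] := inside _ hz; have [m [m0 m1 m2]] := lt_two r0 r'0.
  by exists m => // z' hz'; apply: Hr; [lra|apply: Hr'; lra].
- move=> z hz nsz; have [i [k [e [hd u1]]]] := span_half_disk hz.
  have [si k1 _ _] := hd.
  have kd : 0 < k * crossp (edge i) (- d).
    have kd0 : k * crossp (edge i) d != 0.
      rewrite /crossp u1 mul0r sub0r mulf_neq0 //.
        by case: k1 => ->; rewrite ?oppr_eq0 oner_eq0.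
      rewrite oppr_eq0 mulf_neq0 //; apply: contra_neq (edge_neq0 i) => u2.
      exact: plane_eq.
    rewrite crosspN mulrN oppr_gt0 lt_neqAle kd0 leNgt /=.
    apply/negP => kd; apply: nsz; apply: starts_nearW (span_table hz) _.
    exact: (starts_near_half_disk hd kd).
  have [r r0 Hr] := nbr _ _ hz (starts_near_half_disk hd kd).
  have [r' r'0 Hr'] := inside _ hz; have [m [m0 m1 m2]] := lt_two r0 r'0.
  exists m => // z' hz' sz'.
  have hz'' : lo < z' < hi by apply: Hr'; lra.
  have sz'' : starts (cA, z') (- d) by apply: Hr => //; lra.
  have [i' [k' [e' [hd' _]]]] := span_half_disk hz''.
  have := half_disk_starts hd' sz'; have := half_disk_starts hd' sz''.
  by rewrite crosspN mulrN; lra.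
Qed.

(** Following a given itinerary is an open condition on the starting point. So is failing to follow
    it, because no orbit from the interval runs into a singular point and the next bounce is
    therefore stable. *)
Lemma same_bounces (l r y0 : R) d w q0 : lo <= l -> r <= hi -> l < y0 < r -> d != 0 ->
  (forall y : R, l < y < r -> starts_near (cA, y) d) ->
  (forall (y : R) k, l < y < r -> ~ ends k (cA, y) d) ->
  bounces w (cA, y0) d q0 ->
  forall y : R, l < y < r -> exists q, bounces w (cA, y) d q.
Proof.
move=> ll rh hy0 d0 Hs He.
have span (y : R) : l < y < r -> T (cA, y) by move=> hy; apply: span_table; lra.
have inside (z : R) : l < z < r -> exists2 c, 0 < c & forall z' : R, `|z' - z| < c -> l < z' < r.
  move=> /andP[lz zh].
  have [c [c0 c1 c2]] : exists c, [/\ 0 < c, c < z - l & c < r - z].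
    by apply: lt_two; rewrite subr_gt0.
  by exists c => // z'; rewrite ltr_norml; lra.
elim/last_ind: w q0 => [|w i IH] q0; first by move=> _ y _; exists (cA, y).
move=> bq0; have /bounces_rcons[z0 bz0 _] := bq0.
have {}IH := IH _ bz0.
apply: (@interval_const R (fun y => exists q, bounces (rcons w i) (cA, y) d q) l r y0) => //.
- by exists q0.
- move=> y hy [q bq].
  have [e e0 H] := bounces_stable lohi A_in A_out (span _ hy) (Hs _ hy) bq (@ltr01 R).
  have [c c0 Hc] := inside _ hy; have [m [m0 me mc]] := lt_two e0 c0.
  exists m => // y' yy'.
  have [||q' bq' _] := H (cA, y').
  + by apply: span; apply: Hc; lra.
  + by apply: sq_vert; lra.
  by exists q'.
- move=> y hy nb; have [z bz] := IH _ hy.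
  have sz := bounces_starts_near lohi A_in A_out (Hs _ hy) bz.
  have t0 : turn w d != 0 by apply: contra_neq d0 => t0; rewrite -(turn_rev w d) t0 turn0.
  have Tz : T z.
    move: bz; case/lastP: (w) => [/= ->|v j /bounces_rcons[? _ [_ _ _ /side_table]]//].
    exact: span.
  have [a ha] := hit_exists t0 (starts_nearW Tz sz).
  have nSa : ~ Sig a by move=> Sa; apply: (He y (size w) hy); exists w, z, a.
  have [j sj] := (boundary_side P a).1 (hit_boundary ha).
  have [e e0 H] := hit_stable_regular lohi A_in A_out sz ha nSa sj (@ltr01 R).
  have [e' e'0 H'] := bounces_stable lohi A_in A_out (span _ hy) (Hs _ hy) bz e0.
  have [c c0 Hc] := inside _ hy; have [m [m0 me mc]] := lt_two e'0 c0.
  exists m => // y' yy' [q' /bounces_rcons[z' bz' [hz' nS' nA' si']]].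
  have [||z'' bz'' [zz'' Tz'']] := H' (cA, y').
  + by apply: span; apply: Hc; lra.
  + by apply: sq_vert; lra.
  have [a' ha' [_ nSa' AA sj']] := H _ Tz'' zz''.
  rewrite (bounces_fun bz'' bz') in ha'; rewrite (hit_fun ha' hz') in nSa' AA sj'.
  (* The next point of the orbit of [y'] has the side and the Andreev status of [a], so the orbit of
     [y] would bounce at [a] on side [i] as well. *)
  have ij := side_inj si' sj' (nonvertex nSa'); subst j.
  apply: nb; exists a; apply/bounces_rcons; exists z => //; split => //.
  by rewrite -AA.
Qed.

Variables (D : plane -> Prop) (Dl : seq plane).
Hypothesis D_rfl : forall i d, D d -> D (rfl i d).
Hypothesis D_unit : forall d, D d -> dotp d d = 1.
Hypothesis D_fin : forall d, D d -> d \in Dl.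

Lemma D_neq0 d : D d -> d != 0.
Proof.
move=> /D_unit; apply: contra_eqT; rewrite negbK => /eqP ->.
by rewrite /dotp /= mulr0 addr0 eq_sym oner_eq0.
Qed.

Lemma D_turn w d : D d -> D (turn w d).
Proof. by elim: w d => //= i w IH d /(D_rfl i)/IH. Qed.

Lemma singular_finite : exists s : seq plane, forall p, Sig p -> p \in s.
Proof.
exists ((cA, lo) :: (cA, hi) :: [seq vertex P i | i <- enum 'I_n]).
move=> p [[i ->]|[->|->]]; rewrite !inE ?eqxx ?orbT //.
by rewrite map_f ?orbT // mem_enum.
Qed.

(** By [bounces_inj], tracing back from a singular point with a given final direction leads to at
    most one point of the segment, and there are finitely many such pairs. *)
Lemma ends_finite d : D d -> exists s : seq R,
  forall (y : R) k, lo < y < hi -> ends k (cA, y) d -> y \in s.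
Proof.
move=> Dd; have [ss Hss] := singular_finite.
pose G (x : plane * plane) (y : R) := lo < y < hi /\
  exists w q, [/\ bounces w (cA, y) d q, hit q x.2 x.1 & x.2 = turn w d].
have [|t Ht] := @seq_functional _ _ [seq (a, b) | a <- ss, b <- Dl] G.
  move=> [a b] y y' [hy [w [q [bw /= hq bE]]]] [hy' [w' [q' [bw' /= hq' bE']]]].
  have nO v e (z : R) p : lo < z < hi -> bounces v (cA, z) e p -> ~ O p.
    move=> hz; case/lastP: v => [/= ->|v j /bounces_rcons[? _ [_ _ _ /side_boundary]]].
      by have /boundaryE[] := andreev_boundary (A_in hz).
    by move=> /boundaryE[].
  have qq := hit_back hq hq' (nO _ _ _ _ hy bw) (nO _ _ _ _ hy' bw'); subst q'.
  have [[]//] := bounces_inj (A_in hy) (A_in hy') bw bw' (etrans (esym bE) bE').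
exists t => y k hy [w [q [a [_ bw hq Sa]]]].
apply: (Ht (a, turn w d)); last by split => //; exists w, q.
by apply/allpairsP; exists (a, turn w d); split; [exact: Hss|exact/D_fin/D_turn|].
Qed.

Lemma unit_le1 d : dotp d d = 1 -> `|d.1| <= 1 /\ `|d.2| <= 1.
Proof. by rewrite /dotp => dd; rewrite !ler_norml; split; apply/andP; split; nra. Qed.

Lemma crossp_bound M d p : D d -> `|p.1| <= M /\ `|p.2| <= M -> `|crossp d p| <= 2 * M.
Proof.
move=> /D_unit/unit_le1[d1 d2] [p1 p2].
rewrite /crossp; apply: le_trans (ler_normB _ _) _; rewrite !normrM.
have := ler_pM (normr_ge0 _) (normr_ge0 _) d1 p2.
have := ler_pM (normr_ge0 _) (normr_ge0 _) d2 p1.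
by rewrite !mul1r; lra.
Qed.

(** A finite form of recurrence. If an orbit stayed away too long, two of its bounces would share
    side, direction and transverse cell. A nearby starting point on the segment would then reach the
    later of these points after fewer bounces, which injectivity forbids. *)
Lemma return_dir d : D d ->
  exists N, forall a, A a -> ~ Sig a -> starts a d -> ~ free N a d.
Proof.
move=> Dd; have d0 := D_neq0 Dd.
have Aspan a : A a -> ~ Sig a -> exists2 y : R, lo < y < hi & a = (cA, y).
  move=> Aa nSa; have [a1 a2] := A_regular A_out Aa nSa.
  by exists a.2 => //; apply: plane_eq.
have [[ys [hys sys]]|none] := pselect (exists y : R, lo < y < hi /\ starts (cA, y) d); last first.
  exists 0%N => a Aa nSa sa _; apply: none.
  by have [y hy ay] := Aspan a Aa nSa; exists y; rewrite -ay.
have Hs := span_starts hys sys.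
have d1 := span_starts_fst hys sys.
have [s Hsing] := ends_finite Dd.
have [dl dl0 Hgap] := gaps s lohi.
have [M M0 HM] := table_bounded P.
(* Sliding the starting point by [t] along the segment changes the transverse coordinate by
   [t * d.1]. A change below [eta] therefore slides it by less than half a gap, so a start at the
   middle of a gap stays inside. *)
pose eta := `|d.1| * (dl / 2).
have eta0 : 0 < eta by rewrite mulr_gt0 ?normr_gt0 // divr_gt0.
(* Transverse coordinates range over an interval of length [4 * M], cut into cells of width
   [eta]. *)
pose K := (Num.truncn (4 * M / eta)).+1.
have cell e p : D e -> T p -> (Num.truncn ((crossp e p + 2 * M) / eta) < K)%N.
  move=> De Tp; rewrite ltnS; apply: le_truncn.
  rewrite ler_pM2r ?invr_gt0 //.
  have := crossp_bound De (HM _ Tp); rewrite ler_norml; lra.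
have cellP e p q : D e -> T p -> T q ->
    Num.truncn ((crossp e p + 2 * M) / eta) = Num.truncn ((crossp e q + 2 * M) / eta) ->
    `|crossp e (q - p)| < eta.
  move=> De Tp Tq pq.
  have pos z : T z -> 0 <= (crossp e z + 2 * M) / eta.
    move=> Tz; rewrite divr_ge0 ?(ltW eta0) //.
    by have := crossp_bound De (HM _ Tz); rewrite ler_norml; lra.
  have /andP[a1 a2] := truncn_itv (pos _ Tp).
  have /andP[b1 b2] := truncn_itv (pos _ Tq).
  rewrite pq in a1 a2.
  move: (Num.truncn _) a1 a2 b1 b2 => m.
  rewrite !ler_pdivlMr // !ltr_pdivrMr // -[m.+1%:R]natr1 mulrDl mul1r => a1 a2 b1 b2.
  by rewrite crosspB ltr_norml; lra.
(* One more than the number of triples formed by a side, a direction and a cell. *)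
pose N := #|{: 'I_n * 'I_(size Dl) * 'I_K}|.+1.
exists N => a Aa nSa sa fa.
have [y hy ay] := Aspan a Aa nSa; subst a.
(* The orbit of [y] may run into a singular point after its first [N] bounces. A nearby point
   outside [s] still bounces [N] times and lies in a gap. *)
have [y1 hy1 [y1s fy1]] : exists2 y1 : R, lo < y1 < hi & y1 \notin s /\ free N (cA, y1) d.
  have [e e0 H] := free_stable lohi A_in A_out (span_table hy) (Hs _ hy) fa.
  move: hy => /andP[ly yh].
  have e1 : 0 < hi - y by rewrite subr_gt0.
  have [c [c0 ce ch]] := lt_two e0 e1.
  have [|y1 hy1 y1s] := @interval_notin R s y (y + c); first by lra.
  exists y1; first by lra.
  split => //; apply: H; first by apply: span_table; lra.
  by apply: sq_vert; rewrite ltr_norml; lra.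
have [l [r [ll rh hl dlr Hlr]]] := Hgap _ hy1 y1s.
have [w [q1 [sw bw]]] := fy1.
have span z : l < z < r -> lo < z < hi by lra.
have Hsing' (z : R) k : l < z < r -> ~ ends k (cA, z) d.
  by move=> hz ez; have := Hsing z k (span _ hz) ez; apply/negP/Hlr.
have same v z0 q0 := @same_bounces l r z0 d v q0 ll rh.
have Hsl z : l < z < r -> starts_near (cA, z) d by move=> /span/Hs.
pose y0 := (l + r) / 2.
have hy0 : l < y0 < r by rewrite /y0; lra.
have [q0 bw0] := same _ _ _ hl d0 Hsl Hsing' bw _ hy0.
(* The prefixes have length [k.+1], so that each ends with a bounce: [g k] is the side and the point
   of that bounce. The outgoing direction is not parallel to the side. *)
have /choice[g Hg] : forall k : 'I_N, exists iq : 'I_n * plane,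
    [/\ bounces (take k.+1 w) (cA, y0) d iq.2, side (vertex P) iq.1 iq.2, ~ Sig iq.2,
      exists v, take k.+1 w = rcons v iq.1 & crossp (turn (take k.+1 w) d) (edge iq.1) != 0].
  move=> k; have i0 : 'I_n by case: (w) sw => // i.
  have tk : take k.+1 w = rcons (take k w) (nth i0 w k) by rewrite (take_nth i0) ?sw.
  move: bw0; rewrite -{1}(cat_take_drop k.+1 w) => /bounces_cat[q bq _].
  exists (nth i0 w k, q) => /=.
  have /bounces_rcons[z bz [hz nS nA si]] :
      bounces (rcons (take k w) (nth i0 w k)) (cA, y0) d q by rewrite -tk.
  split => //; first by exists (take k w).
  rewrite tk turn_rcons.
  have [j [c [e [hd _]]]] := regular_disk_exists lohi A_in A_out (hit_boundary hz) nS.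
  have [sj _ _ _] := hd; have ij := side_inj si sj (nonvertex nS); subst j.
  have := hit_half_disk hz hd.
  rewrite [crossp (reflect_dir _ _) _]crosspC crossp_reflect ?edge_neq0 // opprK.
  by apply: contraTneq => ->; rewrite mulr0 ltxx.
have Dt v : turn v d \in Dl by apply/D_fin/D_turn.
have gT k : T (g k).2 by have [_ /side_table] := Hg k.
pose f k : 'I_n * 'I_(size Dl) * 'I_K :=
  ((g k).1, Ordinal (etrans (index_mem _ _) (Dt (take k.+1 w))),
   Ordinal (cell _ _ (D_turn (take k.+1 w) Dd) (gT k))).
have [k1 [k2 [k12 fk]]] : exists k1 k2, k1 <> k2 /\ f k1 = f k2.
  apply: contrapT => H.
  have /leq_card : injective f.
    by move=> k1 k2 f12; apply: contrapT => k12; apply: H; exists k1, k2.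
  by rewrite card_ord /N ltnn.
case: fk => g12 t12 c12.
have {}t12 : turn (take k1.+1 w) d = turn (take k2.+1 w) d.
  by have := congr1 (nth 0 Dl) t12; rewrite !nth_index.
have [b1 s1 nS1 [v1 e1] tr1] := Hg k1; have [b2 s2 nS2 [v2 e2] tr2] := Hg k2.
have De := D_turn (take k1.+1 w) Dd.
set e := turn (take k1.+1 w) d in De t12 c12 tr1.
rewrite -t12 in c12 tr2.
have cp : `|crossp e ((g k2).2 - (g k1).2)| < eta by exact: cellP De (gT _) (gT _) c12.
(* The slide that makes the bounce number [k1] cover exactly the transverse displacement towards the
   bounce number [k2]; the sign is that of [bounces_crossp]. *)
pose t := (-1) ^+ size (take k1.+1 w) * crossp e ((g k2).2 - (g k1).2) / d.1.
have t_small : `|t| < dl / 2.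
  rewrite /t normrM normfV ltr_pdivrMr ?normr_gt0 // normrM normrX normrN1 expr1n mul1r.
  by rewrite mulrC.
have hyt : l < y0 + t < r by move: t_small; rewrite ltr_norml /y0; lra.
have [q bq] := same _ _ _ hy0 d0 Hsl Hsing' b1 _ hyt.
have := bounces_crossp b1 bq; rewrite -/e.
have -> : crossp d ((cA, y0 + t) - (cA, y0)) = t * d.1 by rewrite /crossp !planeE /=; ring.
rewrite /t divfK // mulrA -expr2 -exprM mulnC exprM sqrrN expr1n expr1n mul1r => cq.
have siq : side (vertex P) (g k1).1 q.
  by move: bq; rewrite e1 => /bounces_rcons[z _ [_ _ _]].
rewrite -g12 in s2.
(* Both points lie on the same side and have the same transverse coordinate for a direction that is
   not parallel to this side. *)
have qE : q = (g k2).2.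
  have : crossp (edge (g k1).1) (q - (g k2).2) = 0 by exact: side_crossp siq s2.
  move=> /(crossp_eq0 (edge_neq0 _)); set lam := _ / _ => qE.
  have : crossp e (q - (g k2).2) = 0.
    have -> : q - (g k2).2 = (q - (g k1).2) - ((g k2).2 - (g k1).2).
      by apply: plane_eq; rewrite !planeE; ring.
    by rewrite crosspB cq subrr.
  rewrite qE crosspZ => /eqP; rewrite mulf_eq0 (negPf tr1) orbF => /eqP lam0.
  by apply/eqP; rewrite -subr_eq0 qE lam0 scale0r.
rewrite qE in bq.
(* The two itineraries would coincide although their lengths are [k1 + 1] and [k2 + 1]. *)
have [_ ww] := bounces_inj (A_in (span _ hyt)) (A_in (span _ hy0)) bq b2 t12.
apply: k12; apply: val_inj; have := congr1 size ww.
by rewrite !size_takel ?sw //= => -[].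
Qed.

Lemma return_bound : exists N, forall a d, D d -> A a -> ~ Sig a -> starts a d -> ~ free N a d.
Proof.
suff H (s : seq plane) : exists N, forall a d, d \in s -> D d -> A a -> ~ Sig a -> starts a d -> ~ free N a d.
  by have [N HN] := H Dl; exists N => a d Dd; apply: HN => //; exact: D_fin.
elim: s => [|d s [N IH]]; first by exists 0%N.
have [Dd|nD] := pselect (D d).
  have [N' HN'] := return_dir Dd; exists (maxn N N') => a d'.
  rewrite inE => /orP[/eqP ->|ds] Dd' Aa nSa sa fa.
    by apply: (HN' a) => //; apply: free_le fa; exact: leq_maxr.
  by apply: (IH a d') => //; apply: free_le fa; exact: leq_maxl.
by exists N => a d'; rewrite inE => /orP[/eqP ->|ds] Dd' //; exact: IH.
Qed.
End return_bound.

(** * Every trajectory meets the Andreev segment *)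

Section hitting.
Variables (R : realType) (P : andreev_billiard R) (cA lo hi : R).
Local Notation plane := (R * R)%type.
Implicit Types p q u d x y : plane.
Local Notation T := (table P).
Local Notation O := (table P)°.
Local Notation A := (andreev P).
Local Notation n := (nsides P).
Local Notation hit := (hit P).
Local Notation starts := (starts P).
Local Notation Sig := (singular_point P cA lo hi).
Local Notation rfl i := (reflect_dir (@edge _ P i)).
Local Notation turn := (@turn _ P).
Local Notation free := (free P cA lo hi).
Local Notation ends := (ends P cA lo hi).
Local Notation strikes := (strikes P cA lo hi).
Implicit Types w v : seq 'I_n.

(** Velocities after folding: reflections in the sides of the one table, and reversals, which is
    what Andreev collisions become. *)
Inductive direction d0 : plane -> Prop :=
| direction_start : direction d0 d0
| direction_rfl i d : direction d0 d -> direction d0 (rfl i d)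
| direction_opp d : direction d0 d -> direction d0 (- d).

Hypothesis lohi : lo < hi.
Hypothesis A_in : forall y : R, lo < y < hi -> A (cA, y).
Hypothesis A_out : forall p, A p -> p.1 = cA /\ lo <= p.2 <= hi.

Variables (d0 : plane) (Dl : seq plane).
Local Notation D := (direction d0).
Hypothesis D_unit : forall d, D d -> dotp d d = 1.
Hypothesis D_fin : forall d, D d -> d \in Dl.
Hypothesis d0_fst : d0.1 != 0.
Hypothesis no_connection : forall x d k k', O x -> D d -> ends k x d -> ends k' x (- d) -> False.

Lemma direction_turn w d : D d -> D (turn w d).
Proof. by apply: D_turn => i e; exact: direction_rfl. Qed.

Lemma starts_strikes a d : A a -> ~ Sig a -> starts a d -> exists2 x, O x & strikes 0 x (- d).
Proof.
move=> Aa nSa [s s0 H].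
have s20 : 0 < s / 2 by rewrite divr_gt0.
exists (a + (s / 2) *: d); first by apply: H; lra.
exists [::], (a + (s / 2) *: d), a; split => //=; exists (s / 2); split => //.
- by apply: plane_eq; rewrite !planeE; ring.
- move=> s' hs'.
  have -> : a + s / 2 *: d + s' *: - d = a + (s / 2 - s') *: d.
    by apply: plane_eq; rewrite !planeE; ring.
  by apply: H; lra.
- by have /boundaryE[] := andreev_boundary Aa.
Qed.

Lemma hit_advance y d z : hit y d z -> ~ O y -> exists x, [/\ O x, hit x d z & hit x (- d) y].
Proof.
move=> [t [t0 -> H nO]] nOy.
have t20 : 0 < t / 2 by rewrite divr_gt0.
exists (y + (t / 2) *: d); split; first by apply: H; lra.
- exists (t / 2); split => //.
    by apply: plane_eq; rewrite !planeE; field.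
  move=> s hs.
  have -> : y + t / 2 *: d + s *: d = y + (t / 2 + s) *: d.
    by apply: plane_eq; rewrite !planeE; ring.
  by apply: H; lra.
- exists (t / 2); split => //.
    by apply: plane_eq; rewrite !planeE; ring.
  move=> s hs.
  have -> : y + t / 2 *: d + s *: - d = y + (t / 2 - s) *: d.
    by apply: plane_eq; rewrite !planeE; ring.
  by apply: H; lra.
Qed.

Lemma strikes_advance m y d : strikes m y d -> ~ O y ->
  exists x, [/\ O x, strikes m x d & hit x (- d) y].
Proof.
move=> [w [q [a [sw bw ha Aa nSa]]]] nOy.
case: w sw bw ha => [|i w] sw /=.
  move=> -> ha; have [x [Ox hx hx']] := hit_advance ha nOy.
  by exists x; split => //; exists [::], x, a.
move=> [z hz h] ha; have [x [Ox hx hx']] := hit_advance hz nOy.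
by exists x; split => //; exists (i :: w), q, a; split => //; exists z.
Qed.

Lemma side_regular i : exists2 y, side (vertex P) i y & ~ Sig y.
Proof.
have [s Hs] := singular_finite P cA lo hi.
(* [f] reads off the parameter along the side, so it suffices to avoid the parameters of finitely
   many points. *)
pose f p := dotp (p - vertex P i) (edge i) / dotp (edge i) (edge i).
have [t ht ts] := @interval_notin R [seq f p | p <- s] 0 1 ltr01.
exists (vertex P i + t *: edge i); first by apply/sideP; exists t => //; lra.
move=> /Hs yS; move/negP: ts; apply; apply/mapP; exists (vertex P i + t *: edge i) => //.
rewrite /f addrAC subrr add0r.
have := lt0r_neq0 (dotp_gt0 (edge_neq0 i)); rewrite /dotp !planeE => h.
by field.
Qed.

(** With one sign only, this would not be a closed condition on interior points, because a limit
    orbit may end at a singular point. *)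
Definition struck d x := O x /\ exists m, strikes m x d \/ strikes m x (- d).

Lemma struckN d x : struck (- d) x <-> struck d x.
Proof.
by rewrite /struck opprK; split=> -[Ox [m H]]; split => //; exists m; apply/or_comm.
Qed.

Lemma struck_open d x : struck d x -> exists2 e, 0 < e & forall p, sq x e p -> struck d p.
Proof.
move=> [Ox [m H]]; have [e e0 He] := interior_nbhs Ox; have Tx := interiorT Ox.
have [e' e'0 He'] : exists2 e', 0 < e' &
    forall p, T p -> sq x e' p -> strikes m p d \/ strikes m p (- d).
  case: H => H.
    have [e' e'0 He'] := strikes_stable lohi A_in A_out Tx (starts_near_interior d Ox) H.
    by exists e' => // p Tp xp; left; exact: He'.
  have [e' e'0 He'] := strikes_stable lohi A_in A_out Tx (starts_near_interior (- d) Ox) H.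
  by exists e' => // p Tp xp; right; exact: He'.
have [c [c0 ce ce']] := lt_two e0 e'0.
exists c => // p xp; have Op : O p by apply: He; apply: sqW xp; exact: ltW.
split => //; exists m; apply: He'; first exact: interiorT.
by apply: sqW xp; exact: ltW.
Qed.

(** A strike along [- d], reversed, is an orbit from the segment that passes through [x] and
    continues along [d], so the return bound applies to it. A strike along [d], reversed, has fewer
    than [N] bounces by the same bound, and it interrupts the free orbit. *)
Lemma struck_bound : exists N, forall d x, D d -> struck d x -> ~ free N x d.
Proof.
have [N HN] := return_bound lohi A_in A_out (@direction_rfl d0) D_unit D_fin; exists N.
move=> d x Dd [Ox [m [sm|sm]]] fN.
  rewrite -(opprK d) in sm.
  have [a [d' [Aa nSa sa [w d'E] H]]] := strikes_rev Ox sm.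
  have mN : (m < N)%N.
    rewrite ltnNge; apply/negP => Nm.
    have : free m a d' by rewrite -(addn0 m); apply: H; exists [::], x.
    move=> /(free_le Nm); apply: HN => //; rewrite d'E; apply: direction_turn.
    exact: direction_opp.
  by rewrite opprK in sm; exact: free_strikes fN mN sm.
have [a [d' [Aa nSa sa [w d'E] H]]] := strikes_rev Ox sm.
apply: (HN a d') => //; first by rewrite d'E; exact: direction_turn.
by apply: free_le (H _ fN); exact: leq_addl.
Qed.

(** If [N] free bounces were possible at [x], they would be at nearby struck points, against the
    bound. So along [d] and along [- d] the orbit strikes or ends at a singular point, and the
    second outcome cannot occur in both directions. *)
Lemma struck_closed d x : D d -> O x -> (forall e, 0 < e -> exists2 p, sq x e p & struck d p) ->
  struck d x.
Proof.
move=> Dd Ox H; have Tx := interiorT Ox.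
have [N HN] := struck_bound.
have D0 e : D e -> e != 0 by exact: D_neq0.
have DN := direction_opp Dd.
have nf e : D e -> (forall p, struck d p -> struck e p) -> ~ free N x e.
  move=> De Hde fN.
  have [r r0 Hr] := free_stable lohi A_in A_out Tx (starts_near_interior e Ox) fN.
  have [p xp sp] := H r r0.
  apply: (HN e p De (Hde p sp)); apply: Hr => //; exact: interiorT (proj1 sp).
have [//|[k _ [sk|ek]]] := free_or lohi A_in A_out N (D0 _ Dd) (starts_near_interior d Ox) Tx.
- by move=> /nf; case.
- by split => //; exists k; left.
have [|[k' _ [sk|ek']]] := free_or lohi A_in A_out N (D0 _ DN) (starts_near_interior (- d) Ox) Tx.
- by move=> /nf; case => // p /struckN.
- by split => //; exists k'; right.
- by exfalso; exact: no_connection Ox Dd ek ek'.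
Qed.

Lemma struck_all d x : D d -> (exists y, struck d y) -> O x -> struck d x.
Proof.
move=> Dd ex Ox; pose B := [set y | struck d y].
suff BO : B = O by have : B x by rewrite BO.
apply: (table_connected ex).
- exists B; last by rewrite setIidr // => y [].
  rewrite openE => y /struck_open[e e0 He].
  by apply/nbhs_sq; exists e.
- exists (closure B); first exact: closed_closure.
  apply/seteqP; split=> y.
    by move=> By; split; [case: By|exact: subset_closure].
  by move=> [Oy /closure_sq cy]; exact: struck_closed.
Qed.

(** At the middle of the segment, [d0] or [- d0] points into the table. For a reflection in side
    [i], all interior points are already struck along [d]; a point just before a bounce at a regular
    point [y] of the side then gives one just after it. *)
Lemma struck_exists d : D d -> exists x, struck d x.
Proof.
elim=> {d} [|i d Dd IH|d Dd [x /struckN sx]]; last by exists x.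
- have hm : lo < (lo + hi) / 2 < hi by have := lohi; lra.
  have Aa := A_in hm; have nSa := span_regular A_in hm.
  have [i [k [e [hd u1]]]] := span_half_disk lohi A_in A_out hm.
  have [_ k1 _ _] := hd.
  have kd0 : k * crossp (edge i) d0 != 0.
    rewrite /crossp u1 mul0r sub0r mulf_neq0 //.
      by case: k1 => ->; rewrite ?oppr_eq0 oner_eq0.
    rewrite oppr_eq0 mulf_neq0 //; apply: contra_neq (edge_neq0 i) => u2.
    exact: plane_eq.
  have Ta := span_table A_in hm.
  have [kd|kd|/eqP] := ltrgtP 0 (k * crossp (edge i) d0); last by rewrite eq_sym (negPf kd0).
    have [x Ox sx] := starts_strikes Aa nSa (starts_nearW Ta (starts_near_half_disk hd kd)).
    by exists x; split => //; exists 0%N; right.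
  have kd' : 0 < k * crossp (edge i) (- d0) by rewrite crosspN mulrN oppr_gt0.
  have [x Ox sx] := starts_strikes Aa nSa (starts_nearW Ta (starts_near_half_disk hd kd')).
  by exists x; split => //; exists 0%N; left; rewrite opprK in sx.
have Hall x : O x -> struck d x by exact: struck_all.
have [cd|cd] := eqVneq (crossp (edge i) d) 0.
  by rewrite reflect_dir_par // edge_neq0.
have [y si nSy] := side_regular i.
have [j [k [e [hd _]]]] := regular_disk_exists lohi A_in A_out (side_boundary si) nSy.
have [sj k1 _ _] := hd; have ij := side_inj si sj (nonvertex nSy); subst j.
have nOy : ~ O y by have /boundaryE[] := side_boundary si.
have Ty := side_table si.
have main d1 : k * crossp (edge i) d1 < 0 -> (forall x, O x -> struck d1 x) ->
    exists x, struck (rfl i d1) x.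
  move=> kd Hd1.
  have kr : 0 < k * crossp (edge i) (rfl i d1).
    by rewrite crossp_reflect ?edge_neq0 // mulrN oppr_gt0.
  have sr : starts y (rfl i d1) := starts_nearW Ty (starts_near_half_disk hd kr).
  have [Ay|nAy] := pselect (A y).
    have [x Ox sx] := starts_strikes Ay nSy sr.
    by exists x; split => //; exists 0%N; right.
  have kd' : 0 < k * crossp (edge i) (- d1) by rewrite crosspN mulrN oppr_gt0.
  have [s s0 Hs] := starts_nearW Ty (starts_near_half_disk hd kd').
  have s20 : 0 < s / 2 by rewrite divr_gt0.
  have Ox : O (y + (s / 2) *: - d1) by apply: Hs; lra.
  set x := y + _ in Ox.
  have hxy : hit x d1 y.
    exists (s / 2); split => //; first by rewrite /x; apply: plane_eq; rewrite !planeE; ring.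
    move=> s' hs'; have -> : x + s' *: d1 = y + (s / 2 - s') *: - d1.
      by rewrite /x; apply: plane_eq; rewrite !planeE; ring.
    by apply: Hs; lra.
  (* A strike along [d1] passes through [y] and goes on along the reflected direction. A strike
     along [- d1] also starts from [y], and it is preceded by a flight that comes in along the
     opposite of the reflected direction. *)
  have [_ [m [sm|sm]]] := Hd1 x Ox.
    case: sm => [[|i' w] [q [a [sw /= bw ha Aa nSa]]]].
      by rewrite bw in ha; case: nAy; rewrite (hit_fun hxy ha).
    move: bw => [z hz [nSz nAz siz bz]]; rewrite (hit_fun hz hxy) in siz bz.
    have ii := side_inj siz si (nonvertex nSy); subst i'.
    have sy : strikes (size w) y (rfl i d1) by exists w, q, a.
    have [x' [Ox' sx' _]] := strikes_advance sy nOy.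
    by exists x'; split => //; exists (size w); left.
  have hyx : strikes m y (- d1).
    case: sm => [w [q [a [sw bw ha Aa nSa]]]].
    have ht z : hit x (- d1) z -> hit y (- d1) z by apply: hit_through => //; rewrite opprK.
    case: w sw bw ha => [|i' w] sw /=.
      by move=> -> ha; exists [::], y, a; split => //; exact: ht.
    move=> [z hz h] ha; exists (i' :: w), q, a; split => //.
    by exists z => //; exact: ht.
  have [s' s'0 Hs'] := sr.
  have s'20 : 0 < s' / 2 by rewrite divr_gt0.
  exists (y + (s' / 2) *: rfl i d1); split; first by apply: Hs'; lra.
  exists m.+1; right.
  case: hyx => [w [q [a [sw bw ha Aa nSa]]]].
  have rr : rfl i (- rfl i d1) = - d1 by rewrite reflect_dirN reflect_dirK ?edge_neq0.
  exists (i :: w), q, a; split => //=; rewrite ?sw ?rr //.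
  exists y => //; exists (s' / 2); split => //.
    by apply: plane_eq; rewrite !planeE; ring.
  move=> c hc; have -> : y + s' / 2 *: rfl i d1 + c *: - rfl i d1 = y + (s' / 2 - c) *: rfl i d1.
    by apply: plane_eq; rewrite !planeE; ring.
  by apply: Hs'; lra.
have kd0 : k * crossp (edge i) d != 0.
  by rewrite mulf_neq0 //; case: k1 => ->; rewrite ?oppr_eq0 oner_eq0.
have [kd|kd|/eqP] := ltrgtP (k * crossp (edge i) d) 0; last by rewrite (negPf kd0).
  exact: main.
have [||x] := main (- d); first by rewrite crosspN mulrN oppr_lt0.
  by move=> x /Hall/struckN.
by rewrite reflect_dirN => /struckN; exists x.
Qed.

Lemma free_bound : exists N, forall x d, O x -> D d -> ~ free N x d.
Proof.
have [N HN] := struck_bound; exists N => x d Ox Dd; apply: HN => //.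
by apply: struck_all => //; exact: struck_exists.
Qed.
End hitting.

(** * Angles *)

Lemma near0P (R : realType) (Q : R -> Prop) :
  (\forall r \near (0 : R)^'+, Q r) <-> exists2 e, 0 < e & forall r, 0 < r < e -> Q r.
Proof.
split=> [/nbhs_ballP[e e0 H]|[e e0 H]].
  exists e => // r /andP[r0 re]; apply: H => //.
  by rewrite /ball /= sub0r normrN gtr0_norm.
apply/nbhs_ballP; exists e => // r; rewrite /ball /= sub0r normrN => re r0.
by apply: H; rewrite r0 -(gtr0_norm r0).
Qed.

Section angles.
Variable R : realType.
Local Notation plane := (R * R)%type.
Implicit Types (p u : plane) (t a : R).

Lemma dir_unit t : dotp (dir t) (dir t) = 1 :> R.
Proof. by rewrite /dotp /= -!expr2 cos2Dsin2. Qed.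

Lemma dir_neq0 t : dir t != 0 :> plane.
Proof.
apply/eqP => t0; have := dir_unit t; rewrite t0 /dotp /= mulr0 addr0 => /esym/eqP.
by rewrite oner_eq0.
Qed.

Lemma cos_eq1 t : 0 <= t < 2 * pi -> cos t = 1 -> t = 0.
Proof.
move=> /andP[t0 t2] c1; apply/eqP; rewrite eq_le t0 andbT leNgt; apply/negP => tp.
have s0 : 0 < sin (t / 2) by apply: sin_gt0_pi; lra.
have tE : t / 2 *+ 2 = t by rewrite -mulr_natr divfK.
have := cos_mulr2n (t / 2); rewrite tE c1.
have := cos2Dsin2 (t / 2) => h1 h2.
have : sin (t / 2) ^+ 2 = 0 by lra.
by move=> /eqP; rewrite sqrf_eq0 gt_eqF.
Qed.

Lemma dir_inj t t' : 0 <= t < 2 * pi -> 0 <= t' < 2 * pi -> dir t = dir t' -> t = t'.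
Proof.
move=> h h' [c s]; wlog tt : t t' h h' c s / t <= t'.
  by move=> H; have [/H->//|/ltW/H->//] := leP t t'.
have : t' - t = 0.
  apply: cos_eq1; first by lra.
  by rewrite cosB c s -!expr2 cos2Dsin2.
lra.
Qed.

Lemma dirD t a : dir (t + a) = cos a *: dir t + sin a *: (- sin t, cos t) :> plane.
Proof. by apply: plane_eq; rewrite !planeE /= ?cosD ?sinD; ring. Qed.

Lemma dirDpi t : dir (t + pi) = - dir t :> plane.
Proof. by apply: plane_eq; rewrite !planeE /= ?cosDpi ?sinDpi. Qed.

Lemma dirD2pi t (k : int) : dir (t + k%:~R * (2 * pi)) = dir t :> plane.
Proof.
have nat_case (j : nat) s : dir (s + j%:R * (2 * pi)) = dir s :> plane.
  elim: j => [|j IH]; first by rewrite mul0r addr0.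
  have -> : s + j.+1%:R * (2 * pi) = (s + j%:R * (2 * pi) + pi) + pi by rewrite -natr1; ring.
  by rewrite !dirDpi opprK IH.
case: k => j; first exact: nat_case.
rewrite NegzE mulrNz -(nat_case j.+1 (t + _)); congr dir; rewrite mulNr subrK //.
Qed.

Lemma reflect_dir_dir u f t : u != 0 -> crossp (dir f) u = 0 ->
  reflect_dir u (dir t) = dir (2 * f - t).
Proof.
move=> u0 /(crossp_eq0 (dir_neq0 f)); set l := _ / _ => uE.
have l0 : l != 0 by apply: contra_neq u0 => l0; rewrite uE l0 scale0r.
have cf := cos2Dsin2 f.
have dd : dotp u u = l ^+ 2.
  rewrite uE /dotp !planeE /=; transitivity (l ^+ 2 * (cos f ^+ 2 + sin f ^+ 2)); first by ring.
  by rewrite cf mulr1.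
have du : dotp (dir t) u = l * (cos t * cos f + sin t * sin f).
  by rewrite uE /dotp !planeE /=; ring.
have e (z : R) : 2 * dotp (dir t) u / dotp u u * (l * z) =
    2 * (cos t * cos f + sin t * sin f) * z.
  by rewrite dd du; field.
have -> : 2 * f = f + f by ring.
apply: plane_eq; rewrite /reflect_dir !planeE [in LHS]uE !planeE.
  rewrite -uE e /= cosB cosD sinD.
  have : cos t * (cos f ^+ 2 + sin f ^+ 2) = cos t by rewrite cf mulr1.
  lra.
rewrite -uE e /= sinB cosD sinD.
have : sin t * (cos f ^+ 2 + sin f ^+ 2) = sin t by rewrite cf mulr1.
lra.
Qed.

(** The angles [f] and [t] differ by a multiple of [pi], since both directions are parallel to
    [u]. *)
Lemma par_shift f t a u v : u != 0 -> crossp (dir f) u = 0 -> crossp (dir t) u = 0 ->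
  crossp (dir (t + a)) v = 0 -> crossp (dir (f + a)) v = 0.
Proof.
move=> u0 fu /(crossp_eq0 (dir_neq0 t)); set l := _ / _ => uE tv.
have l0 : l != 0 by apply: contra_neq u0 => l0; rewrite uE l0 scale0r.
have s0 : sin (f - t) = 0.
  move: fu; rewrite uE crosspZ => /eqP; rewrite mulf_eq0 (negPf l0) /= => /eqP.
  by rewrite sinB /crossp /=; lra.
have -> : f + a = (t + a) + (f - t) by ring.
by rewrite dirD s0 scale0r addr0 crosspC crosspZ crosspC tv oppr0 mulr0 oppr0.
Qed.

(** In this range each direction has at most one angle, so the set is a countable union of sets with
    at most one point. *)
Lemma negligible_dir (I : countType) (F : I -> plane) :
  (@lebesgue_measure R).-negligible [set t | 0 <= t < 2 * pi /\ exists i, dir t = F i].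
Proof.
pose B (m : nat) := [set t : R | 0 <= t < 2 * pi /\ exists2 i, unpickle m = Some i & dir t = F i].
have Bneg m : (@lebesgue_measure R).-negligible (B m).
  have [[t0 Bt0]|nB] := pselect (exists t, B m t).
    have : (@lebesgue_measure R).-negligible [set t0].
      by apply/negligibleP; [exact: measurable_set1|exact: lebesgue_measure_set1].
    apply: negligibleS => t [ht [i mi ti]] /=; case: Bt0 => ht0 [i0 mi0 ti0].
    by apply: dir_inj => //; rewrite ti ti0; move: mi; rewrite mi0 => -[->].
  apply: negligibleS (negligible_set0 _) => t Bt; exfalso; apply: nB; by exists t.
apply: negligibleS (negligible_bigcup Bneg) => t [ht [i ti]].
by exists (pickle i) => //; split => //; exists i; rewrite ?pickleK.
Qed.
End angles.

(** * The two sides at a corner and the angle between them *)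

Section finiteness.
Variables (R : realType) (P : andreev_billiard R).
Local Notation plane := (R * R)%type.
Implicit Types p q u d x y : plane.
Local Notation T := (table P).
Local Notation n := (nsides P).
Hypothesis Prat : rational_billiard P.

Lemma vertex_only_sides i j : side (vertex P) j (vertex P (ordS i)) -> j = i \/ j = ordS i.
Proof.
have [_ H0 H1 H2] := billiard_polygon P.
move=> sj; have [ji|/eqP ji] := eqVneq j i; first by left.
have [jS|jS] := eqVneq j (ordS i); first by right.
exfalso; have vS := side_vertex (ordS i).
have [jSS|jSS] := eqVneq j (ordS (ordS i)).
  have : (side (vertex P) (ordS i) `&` side (vertex P) (ordS (ordS i))) (vertex P (ordS i)) by rewrite -jSS.
  rewrite H1 => /= e; have := edge_neq0 (ordS i).
  by rewrite edgeE -e subrr eqxx.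
have : (side (vertex P) (ordS i) `&` side (vertex P) j) (vertex P (ordS i)) by [].
rewrite H2 //; apply/eqP => /(bij_inj (ordS_bij _)) ij; exact: ji.
Qed.

Lemma dir_cont v (r t e : R) : 0 < e -> exists2 dl, 0 < dl &
  forall t', `|t' - t| < dl -> sq (v + r *: dir t) e (v + r *: dir t').
Proof.
move=> e0.
have cont (f : R -> R) (c : R) : {for t, continuous f} -> exists2 dl, 0 < dl &
    forall t', `|t' - t| < dl -> `|c + r * f t' - (c + r * f t)| < e.
  move=> cf.
  have r1 : 0 < `|r| + 1 by rewrite ltr_wpDl.
  have er : 0 < e / (`|r| + 1) by rewrite divr_gt0.
  have /cvgrPdist_lt/(_ _ er)/nbhs_ballP[dl dl0 H] := cf.
  exists dl => // t' tt'.
  have : `|f t - f t'| < e / (`|r| + 1) by apply: H; rewrite /ball /= distrC.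
  rewrite distrC ltr_pdivlMr // => h.
  have -> : c + r * f t' - (c + r * f t) = (f t' - f t) * r by ring.
  rewrite normrM; apply: le_lt_trans h.
  by rewrite ler_wpM2l // lerDl.
have [d1 d10 H1] := cont (@cos R) v.1 (@continuous_cos R t).
have [d2 d20 H2] := cont (@sin R) v.2 (@continuous_sin R t).
have [dl [dl0 h1 h2]] := lt_two d10 d20.
by exists dl => // t' tt'; split; rewrite !planeE /=; [apply: H1|apply: H2]; lra.
Qed.

(** Both unit vectors would be equal, forcing [cos a = 1]. Thus the two rays that bound a corner lie
    on different sides. *)
Lemma same_ray (t a l l' : R) u : 0 < a < 2 * pi -> dir t = l *: u -> dir (t + a) = l' *: u ->
  0 <= l * l' -> False.
Proof.
move=> ha e e' ll.
have uu1 : l ^+ 2 * dotp u u = 1.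
  by rewrite -(dir_unit t) e /dotp !planeE; ring.
have uu2 : l' ^+ 2 * dotp u u = 1.
  by rewrite -(dir_unit (t + a)) e' /dotp !planeE; ring.
have ca : cos a = l * l' * dotp u u.
  have -> : a = (t + a) - t by ring.
  rewrite cosB.
  transitivity (dotp (dir t) (dir (t + a))); first by rewrite /dotp /=; ring.
  by rewrite e e' /dotp !planeE; ring.
have u0 : 0 < dotp u u.
  apply: dotp_gt0; apply: contra_eq_neq uu1 => ->.
  by rewrite /dotp /= mulr0 addr0 mulr0 eq_sym oner_neq0.
have c1 : cos a ^+ 2 = 1.
  rewrite ca; transitivity ((l ^+ 2 * dotp u u) * (l' ^+ 2 * dotp u u)); first by ring.
  by rewrite uu1 uu2 mulr1.
have c0 : 0 <= cos a by rewrite ca mulr_ge0 // ltW.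
have ca1 : cos a = 1.
  by move/eqP: c1; rewrite sqrf_eq1 => /orP[/eqP //|/eqP c1]; move: c0; rewrite c1; lra.
by have := cos_eq1 (_ : 0 <= a < 2 * pi) ca1; lra.
Qed.

(** Side [i] arrives at the corner [ordS i] while side [ordS i] leaves it, hence the sign. *)
Lemma side_ray i j p : j = i \/ j = ordS i -> side (vertex P) j p ->
  exists2 l : R, 0 <= l &
    p - vertex P (ordS i) = l *: ((if j == i then -1 else 1) *: edge j).
Proof.
move=> [->|->] /sideP[t /andP[t0 t1] ->].
  exists (1 - t); first by lra.
  by rewrite eqxx edgeE; apply: plane_eq; rewrite !planeE; ring.
have -> : ordS i == i = false.
  apply/eqP => e; have [_ H _ _] := billiard_polygon P; have := H i.
  by rewrite !e crosspp eqxx.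
exists t => //.
by rewrite edgeE; apply: plane_eq; rewrite !planeE; ring.
Qed.

(** On a small circle around the corner, the points at angles [t] and [t + a] belong to the table
    but are limits of points outside it. They are boundary points, hence on the two adjacent sides,
    one on each. The orientation of the polygon is not known, so either order may occur. *)
Lemma vertex_angle (i : 'I_n) : exists t a, (exists q : rat, a = ratr q * pi) /\
  ((crossp (dir t) (edge i) = 0 /\ crossp (dir (t + a)) (edge (ordS i)) = 0) \/
   (crossp (dir t) (edge (ordS i)) = 0 /\ crossp (dir (t + a)) (edge i) = 0)).
Proof.
set v := vertex P (ordS i).
have [a [ha [t /near0P[r1 r10 Hr]]] qa] := Prat (ordS i).
exists t, a; split => //.
have [e e0 He] : exists2 e, 0 < e &
    forall p, sq v e p -> forall j, side (vertex P) j p -> j = i \/ j = ordS i.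
  apply: sq_forall => j.
  have [jj|nj] := pselect (j = i \/ j = ordS i); first by exists 1.
  have [|e e0 H] := @closed_avoid R (side (vertex P) j) v (@side_closed _ _ j).
    by move=> sj; apply: nj; exact: vertex_only_sides.
  by exists e => // p /H.
have [r [r0 rr1 re]] := lt_two r10 e0.
have {}Hr s : 0 <= s < 2 * pi -> T (v + r *: dir (t + s)) <-> s <= a.
  by apply: Hr; rewrite r0.
have near s : sq v e (v + r *: dir s).
  have [d1 d2] := unit_le1 (dir_unit s).
  have h (c x : R) : `|c| <= 1 -> `|x + r * c - x| < e.
    move=> c1; rewrite addrAC subrr add0r normrM (gtr0_norm r0).
    by apply: le_lt_trans re; rewrite ler_piMr // ltW.
  by split; rewrite !planeE; apply: h.
have bd s : (forall dl, 0 < dl -> exists2 s', `|s' - s| < dl & ~ T (v + r *: dir s')) ->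
    T (v + r *: dir s) -> exists2 j, (j = i \/ j = ordS i) & side (vertex P) j (v + r *: dir s).
  move=> H Ts; have : boundary T (v + r *: dir s).
    apply/boundaryE; split => // /interior_nbhs[c c0 Hc].
    have [dl dl0 Hdl] := dir_cont v r s c0.
    have [s' ss' nT] := H _ dl0.
    by apply: nT; apply/interiorT/Hc/Hdl.
  by move=> /boundary_side[j sj]; exists j => //; apply: He sj.
have pi0 : 0 < 2 * pi :> R by rewrite mulr_gt0 // pi_gt0.
have [||j0 hj0 sj0] := bd t.
- move=> dl dl0.
  have g0 : 0 < 2 * pi - a by lra.
  have [c [c0 cdl ca]] := lt_two dl0 g0.
  (* Just before [t] means, modulo [2 * pi], at angle [2 * pi - c] from the first ray, which exceeds
     the opening [a]. *)
  exists (t - c); first by rewrite addrAC subrr add0r normrN gtr0_norm.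
  have -> : dir (t - c) = dir (t + (2 * pi - c)) :> plane.
    by rewrite -(dirD2pi _ 1) mul1r; congr dir; ring.
  by rewrite Hr; lra.
- by rewrite -[t in dir t]addr0 Hr; lra.
have [||ja hja sja] := bd (t + a).
- move=> dl dl0.
  have g0 : 0 < 2 * pi - a by lra.
  have [c [c0 cdl ca]] := lt_two dl0 g0.
  exists (t + (a + c)); last by rewrite Hr; lra.
  have -> : t + (a + c) - (t + a) = c by ring.
  by rewrite gtr0_norm.
- by rewrite Hr; lra.
have [l0 l00 e0'] := side_ray hj0 sj0; have [la la0 ea] := side_ray hja sja.
rewrite -/v addrAC subrr add0r in e0'; rewrite -/v addrAC subrr add0r in ea.
have sc z (l : R) (u : plane) : r *: z = l *: u -> z = (l / r) *: u.
  move=> /(congr1 (fun p => r^-1 *: p)); rewrite !scalerA mulVf ?gt_eqF // scale1r => ->.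
  by rewrite mulrC.
have jj : j0 <> ja.
  move=> jj; rewrite jj in e0'.
  apply: (same_ray ha (sc _ _ _ e0') (sc _ _ _ ea)).
  by rewrite mulr_ge0 // divr_ge0 // ltW.
have cr s j (l : R) : r *: dir s = l *: ((if j == i then -1 else 1) *: edge j) -> crossp (dir s) (edge j) = 0.
  by move=> /sc ->; rewrite crosspC !crosspZ crosspp !mulr0 oppr0.
move/cr: e0'; move/cr: ea.
by case: hj0 jj => ->; case: hja => -> // jj; [left|right].
Qed.
End finiteness.

(** * Exceptional directions *)

Section finite_directions.
Variables (R : realType) (P : andreev_billiard R).
Local Notation plane := (R * R)%type.
Implicit Types p q u d x y : plane.
Local Notation n := (nsides P).
Hypothesis Prat : rational_billiard P.

(** Going around the polygon from side 0, each corner adds or subtracts a rational multiple of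
    [pi]. *)
Lemma side_angles : exists f : R, forall i : 'I_n, exists q : rat,
  crossp (dir (f + ratr q * pi)) (edge i) = 0.
Proof.
have [n3 _ _ _] := billiard_polygon P.
have n0 : (0 < n)%N by exact: leq_trans n3.
have [f Hf] : exists f : R, crossp (dir f) (edge (Ordinal n0)) = 0.
  by have [t [a [_ [[h _]|[_ h]]]]] := vertex_angle Prat (Ordinal n0); eexists; exact: h.
exists f => -[m mn]; elim: m mn => [|m IH] mn.
  by exists 0; rewrite rmorph0 mul0r addr0 (_ : Ordinal mn = Ordinal n0) //; exact: val_inj.
have mn' : (m < n)%N by exact: ltnW.
have [q Hq] := IH mn'.
have iS : Ordinal mn = ordS (Ordinal mn') by apply: val_inj; rewrite /= modn_small.
have [t [a [[q' ->] [[h1 h2]|[h1 h2]]]]] := vertex_angle Prat (Ordinal mn'); rewrite iS.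
- exists (q + q'); rewrite rmorphD mulrDl addrA.
  exact: par_shift (edge_neq0 _) Hq h1 h2.
- exists (q - q'); rewrite rmorphB mulrBl addrA.
  apply: (par_shift (edge_neq0 _) Hq h2).
  by rewrite addrK.
Qed.

Lemma common_denominator (q : 'I_n -> rat) : exists2 N : nat, (0 < N)%N &
  forall i, exists z : int, ratr (q i) = z%:~R / N%:R :> R.
Proof.
exists (\prod_i `|denq (q i)|)%N.
  by apply: prodn_gt0 => i; rewrite absz_gt0 denq_neq0.
move=> i; rewrite (bigD1 i) //=; set M := (\prod_(_ | _) _)%N.
have M0 : (0 < M)%N by apply: prodn_gt0 => j; rewrite absz_gt0 denq_neq0.
exists (numq (q i) * M%:Z).
have M0' : M%:R != 0 :> R by rewrite pnatr_eq0 -lt0n.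
have d0 : (denq (q i))%:~R != 0 :> R by rewrite intr_eq0 denq_neq0.
have dE : `|denq (q i)|%:R = (denq (q i))%:~R :> R.
  by rewrite -[in RHS](gtz0_abs (denq_gt0 _)).
rewrite natrM dE /ratr intrM; field; apply/andP; split => //.
Qed.

Lemma directions_finite t : exists Dl : seq plane,
  forall d, direction P (dir t) d -> d \in Dl.
Proof.
have [f /choice[q Hq]] := side_angles.
have [N N0 /choice[z Hz]] := common_denominator q.
(* Reflection in a line of angle [f + z * pn] maps the angle [s] to [2 * f - s + 2 * z * pn]. It
   exchanges the two bases up to multiples of [pn], and a reversal adds [N * pn]. *)
pose base (b : bool) := if b then t else 2 * f - t.
pose pn : R := pi / N%:R.
have N0' : N%:R != 0 :> R by rewrite pnatr_eq0 -lt0n.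
have piE : pi = N%:R * pn by rewrite /pn mulrC divfK.
have form d : direction P (dir t) d -> exists b (k : int), d = dir (base b + k%:~R * pn).
  elim=> {d} [|i d _ [b [k ->]]|d _ [b [k ->]]].
  - by exists true, 0; rewrite mul0r addr0.
  - exists (~~ b), (2 * z i - k).
    rewrite (reflect_dir_dir _ (edge_neq0 i) (Hq i)) Hz.
    congr dir; rewrite intrB intrM /base /pn; case: b => /=; field => //.
  - exists b, (k + N%:Z); rewrite -dirDpi; congr dir.
    by rewrite intrD [in LHS]piE; ring.
(* A full turn is [2 * N] times [pn], so the multiples of [pn] matter only modulo [2 * N]. *)
exists [seq dir (base b + j%:R * pn) | b <- [:: true; false], j <- iota 0 (2 * N)].
move=> d /form[b [k ->]].
have N20 : (2 * N)%:Z != 0 by rewrite -lt0n muln_gt0.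
pose r := modz k (2 * N)%:Z.
have r0 : 0 <= r by exact: modz_ge0.
have rN : r < (2 * N)%:Z by apply: ltz_pmod; rewrite ltz_nat muln_gt0.
have -> : dir (base b + k%:~R * pn) = dir (base b + r%:~R * pn) :> plane.
  rewrite -(dirD2pi (base b + r%:~R * pn) (divz k (2 * N)%:Z)).
  rewrite [in LHS](divz_eq k (2 * N)%:Z) -/r; congr dir.
  by rewrite intrD intrM PoszM intrM [in RHS]piE; ring.
apply/allpairsP; exists (b, `|r|%N); split.
- by case: b; rewrite !inE.
- by rewrite mem_iota add0n /= -ltz_nat gez0_abs.
- by rewrite /= -[in LHS](gez0_abs r0).
Qed.

Lemma direction_unit t d : direction P (dir t) d -> dotp d d = 1.
Proof.
elim=> {d} [|i d _ IH|d _ IH]; first exact: dir_unit.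
  by rewrite dotp_reflect // edge_neq0.
by rewrite -IH /dotp !planeE; ring.
Qed.

Lemma direction_back d0 d : direction P d0 d -> exists w, d0 = turn w d \/ d0 = - turn (P := P) w d.
Proof.
elim=> {d} [|i d _ [w H]|d _ [w H]]; first by exists [::]; left.
  by exists (i :: w) => /=; rewrite reflect_dirK // edge_neq0.
by exists w; rewrite turnN opprK; case: H; [right|left].
Qed.
End finite_directions.

(** * Unfolding of trajectories into straight lines *)

Section unfolding.
Variables (R : realType) (P : andreev_billiard R) (cA lo hi : R).
Local Notation plane := (R * R)%type.
Implicit Types p q u d x y : plane.
Local Notation n := (nsides P).
Local Notation hit := (hit P).
Local Notation Sig := (singular_point P cA lo hi).
Local Notation rfl i := (reflect_dir (@edge _ P i)).
Local Notation bounces := (@bounces _ P cA lo hi).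
Local Notation turn := (@turn _ P).
Local Notation ends := (ends P cA lo hi).
Implicit Types w v : seq 'I_n.

(** The reflection of the plane in the line of side [i]. *)
Definition reflect_pt (i : 'I_n) p := vertex P i + rfl i (p - vertex P i).
Definition unfold w p := foldr reflect_pt p w.

Lemma reflect_dirD u p q : reflect_dir u (p + q) = reflect_dir u p + reflect_dir u q.
Proof. by apply: plane_eq; rewrite /reflect_dir /dotp !planeE; ring. Qed.
Lemma reflect_dirZ u (l : R) p : reflect_dir u (l *: p) = l *: reflect_dir u p.
Proof. by apply: plane_eq; rewrite /reflect_dir /dotp !planeE; ring. Qed.

(** Reflecting what follows a bounce in the side that is hit replaces the bounce by a straight
    continuation. *)
Lemma unfold_bounces w x d y q : bounces w x d y -> hit y (turn w d) q ->
  exists2 l, 0 < l & unfold w q = x + l *: d.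
Proof.
elim: w x d => [|i w IH] x d /=; first by move=> -> [t [t0 -> _ _]]; exists t.
move=> [z [t [t0 zE _ _]] [_ _ si b]] hq; have [l l0 ->] := IH _ _ b hq.
exists (t + l); first exact: addr_gt0.
rewrite /reflect_pt addrAC reflect_dirD reflect_dirZ reflect_dirK ?edge_neq0 //.
rewrite (reflect_dir_par (edge_neq0 i) (side_crossp si (side_vertex i))).
by rewrite zE; apply: plane_eq; rewrite !planeE; ring.
Qed.

Definition normalize p := (Num.sqrt (dotp p p))^-1 *: p.

Lemma normalizeZ (l : R) d : 0 < l -> dotp d d = 1 -> normalize (l *: d) = d.
Proof.
move=> l0 dd; rewrite /normalize.
have -> : dotp (l *: d) (l *: d) = l ^+ 2.
  by transitivity (l ^+ 2 * dotp d d); [rewrite /dotp !planeE; ring|rewrite dd mulr1].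
by rewrite sqrtr_sqr gtr0_norm // scalerA mulVf ?gt_eqF // scale1r.
Qed.

(** Unfolded, the two singular points lie on the line through [x] along [d], on opposite sides of
    [x], so their difference determines [d]. *)
Lemma ends_normalize x d k k' : dotp d d = 1 -> ends k x d -> ends k' x (- d) ->
  exists w w' a a', [/\ Sig a, Sig a' & d = normalize (unfold w a - unfold w' a')].
Proof.
move=> dd [w [y [a [_ b ha Sa]]]] [w' [y' [a' [_ b' ha' Sa']]]].
have [l l0 e] := unfold_bounces b ha; have [l' l'0 e'] := unfold_bounces b' ha'.
exists w, w', a, a'; split => //; rewrite e e'.
have -> : x + l *: d - (x + l' *: - d) = (l + l') *: d.
  by apply: plane_eq; rewrite !planeE; ring.
by rewrite normalizeZ // addr_gt0.
Qed.

(* [normalize] gives the direction of a connection, which the reversed word [v]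
   carries back to the initial direction, up to sign. *)
Definition exceptional (s : seq plane) (c : seq 'I_n * seq 'I_n * seq 'I_n * nat * nat * bool) : plane :=
  let: (v, w, w', k, k', b) := c in
  (-1) ^+ b *: turn v (normalize (unfold w (nth 0 s k) - unfold w' (nth 0 s k'))).

(** [F] is chosen before the direction, so the exceptional directions form one countable family,
    indexed by words, positions in the list of singular points and a sign. *)
Lemma generic_direction : exists (F : seq 'I_n * seq 'I_n * seq 'I_n * nat * nat * bool -> plane),
  forall d0, (forall d, direction P d0 d -> dotp d d = 1) -> (forall c, d0 <> F c) ->
  forall x d k k', direction P d0 d -> ends k x d -> ends k' x (- d) -> False.
Proof.
have [s Hs] := singular_finite P cA lo hi.
exists (exceptional s) => d0 U ne x d k k' Dd e e'.
have [w [w' [a [a' [Sa Sa' dE]]]]] := ends_normalize (U _ Dd) e e'.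
have [v Hv] := direction_back Dd.
have h (b : bool) : d0 = (-1) ^+ b *: turn v d -> False.
  move=> d0E; have := ne (v, w, w', index a s, index a' s, b); apply.
  by rewrite /exceptional !nth_index ?Hs // -dE.
by case: Hv => hv; [apply: (h false)|apply: (h true)]; rewrite hv ?expr0 ?scale1r ?expr1 ?scaleN1r.
Qed.
End unfolding.

(** * Folding the two copies *)

Section folding.
Variables (R : realType) (P : andreev_billiard R) (cA lo hi : R).
Local Notation plane := (R * R)%type.
Implicit Types (p q u d x y : plane) (z w : state R) (b : bool).
Local Notation T := (table P).
Local Notation O := (table P)°.
Local Notation A := (andreev P).
Local Notation n := (nsides P).
Local Notation rfl i := (reflect_dir (@edge _ P i)).

Hypothesis lohi : lo < hi.
Hypothesis A_in : forall y : R, lo < y < hi -> A (cA, y).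
Hypothesis A_out : forall p, A p -> p.1 = cA /\ lo <= p.2 <= hi.

Definition mirror d : plane := (- d.1, d.2).
Definition fold b p := if b then p else rho P p.
Definition fold_dir b d := if b then d else mirror d.
Definition fpos z := fold (copy z) (pos z).
Definition fvel z := fold_dir (copy z) (vel z).
(* The effect of an Andreev collision: after folding, a mere velocity reversal. *)
Definition retro z := State (~~ copy z) (rho P (pos z)) (- mirror (vel z)).

Lemma rhoK : involutive (rho P).
Proof. by move=> p; apply: plane_eq => //=; ring. Qed.

Lemma mirrorK : involutive mirror.
Proof. by move=> p; apply: plane_eq => //=; rewrite opprK. Qed.

Lemma mirrorN d : mirror (- d) = - mirror d. Proof. by apply: plane_eq. Qed.

Lemma foldK b : involutive (fold b). Proof. by case: b => // p; exact: rhoK. Qed.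
Lemma fold_dirK b : involutive (fold_dir b). Proof. by case: b => // p; exact: mirrorK. Qed.
Lemma fold_negb b p : fold (~~ b) (rho P p) = fold b p.
Proof. by case: b => //=; rewrite rhoK. Qed.
Lemma fold_dir_negb b d : fold_dir (~~ b) d = mirror (fold_dir b d).
Proof. by case: b => //=; rewrite mirrorK. Qed.
Lemma fold_dirN b d : fold_dir b (- d) = - fold_dir b d.
Proof. by case: b => //=; rewrite mirrorN. Qed.

Lemma rho_image (X : set plane) p : (rho P @` X) p <-> X (rho P p).
Proof. by split=> [[q Xq <-]|Xp]; [rewrite rhoK|exists (rho P p); rewrite ?rhoK]. Qed.

Lemma sq_rho p e q : sq (rho P p) e (rho P q) <-> sq p e q.
Proof.
rewrite /sq /=; have -> : 2 * axis P - q.1 - (2 * axis P - p.1) = - (q.1 - p.1) by ring.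
by rewrite normrN.
Qed.

Lemma boundaryC_fold b p : boundaryC P b p <-> boundary T (fold b p).
Proof. by case: b => //=; exact: rho_image. Qed.
Lemma andreevC_fold b p : andreevC P b p <-> A (fold b p).
Proof. by case: b => //=; exact: rho_image. Qed.

Lemma in_interior_fold z : in_interior P z <-> O (fpos z).
Proof.
case: z => -[] p v //; rewrite /in_interior /fpos /=.
split=> /nbhs_sq[e e0 H]; apply/nbhs_sq; exists e => // q.
  by rewrite -(rhoK q) => /sq_rho/H/rho_image.
by move=> pq; apply/rho_image/H/sq_rho.
Qed.

Lemma on_wall_fold z : on_wall P z <-> boundary T (fpos z) /\ ~ A (fpos z).
Proof. by split=> -[/boundaryC_fold h1 h2]; split=> // /andreevC_fold. Qed.

Lemma vertexC_fold b i : fold b (@vertexC _ P b i) = vertex P i.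
Proof. by case: b => //=; exact: rhoK. Qed.

Lemma vertexC_eq b x i : x = @vertexC _ P b i <-> fold b x = vertex P i.
Proof.
by split=> [->|h]; [exact: vertexC_fold|rewrite -(foldK b x) h -(vertexC_fold b i) foldK].
Qed.

Lemma edgeC b i : @vertexC _ P b (ordS i) - @vertexC _ P b i = fold_dir b (edge i).
Proof.
rewrite edgeE; case: b => //=; apply: plane_eq; rewrite !planeE /=; last by [].
by ring.
Qed.

Lemma sideC_fold b i x : side (@vertexC _ P b) i x <-> side (vertex P) i (fold b x).
Proof.
have e (t : R) : fold b ((1 - t) *: @vertexC _ P b i + t *: @vertexC _ P b (ordS i)) =
    (1 - t) *: vertex P i + t *: vertex P (ordS i).
  by case: b => //; apply: plane_eq; rewrite /= /GRing.scale /=; ring.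
split=> [[t ht <-]|[t ht tx]]; first by rewrite e; exists t.
by exists t => //; rewrite -[LHS](foldK b) e tx foldK.
Qed.

Lemma reflect_dir_fold b u d :
  fold_dir b (reflect_dir (fold_dir b u) d) = reflect_dir u (fold_dir b d).
Proof.
case: b => //=.
have e1 : dotp d (mirror u) = dotp (mirror d) u by rewrite /dotp /=; ring.
have e2 : dotp (mirror u) (mirror u) = dotp u u by rewrite /dotp /=; ring.
by rewrite /reflect_dir e1 e2; apply: plane_eq; rewrite /= /GRing.scale /=; ring.
Qed.

Definition bounce y d d' := exists i : 'I_n,
  [/\ side (vertex P) i y, forall j, y <> vertex P j & d' = rfl i d].

Lemma reflected_fold b x d d' :
  reflected P b x d d' <-> bounce (fold b x) (fold_dir b d) (fold_dir b d').
Proof.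
split=> -[i [h1 h2 h3]]; exists i; split.
- exact/sideC_fold.
- by move=> j /vertexC_eq; exact: h2.
- by rewrite h3 edgeC reflect_dir_fold.
- exact/sideC_fold.
- by move=> j /vertexC_eq; exact: h2.
- by rewrite edgeC -[LHS](fold_dirK b) h3 -reflect_dir_fold fold_dirK.
Qed.

Lemma bounce_andreev y d d' : A y -> bounce y d d' <-> d' = mirror d.
Proof.
move=> Ay; have nv i : y <> vertex P i.
  by move=> yi; apply: (@andreev_vertex _ P i); rewrite -yi.
have [i [k [e hd]]] := half_disk_exists (andreev_boundary Ay) nv.
have u1 := andreev_edge lohi A_in A_out Ay hd; have [si _ _ _] := hd.
have r : rfl i d = mirror d by rewrite reflect_dir_vert ?edge_neq0.
split=> [[j [sj _ ->]]|->]; first by rewrite (side_inj sj si nv).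
by exists i; split.
Qed.

Lemma bounce_rev y d d' : bounce y d d' -> bounce y (- d') (- d).
Proof.
by move=> [i [h1 h2 ->]]; exists i; split=> //; rewrite reflect_dirN reflect_dirK // edge_neq0.
Qed.

Lemma bounce_fun y d d1 d2 : bounce y d d1 -> bounce y d d2 -> d1 = d2.
Proof. by move=> [i [si nv ->]] [j [sj _ ->]]; rewrite (side_inj si sj nv). Qed.

Lemma fpos_advance s z : fpos (advance s z) = fpos z + s *: fvel z.
Proof.
by case: z => -[] p v //; apply: plane_eq; rewrite /fpos /fvel /= /GRing.scale /=; ring.
Qed.

Lemma state_eq z w : copy z = copy w -> fpos z = fpos w -> fvel z = fvel w -> z = w.
Proof.
rewrite /fpos /fvel; case: z w => [b p v] [b' p' v'] /= -> hp hv.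
by rewrite -(foldK b' p) hp foldK -(fold_dirK b' v) hv fold_dirK.
Qed.

(** For an Andreev collision, the law of the vertical side contributes a mirror and a sign. The
    change of copy contributes a second mirror, so only the sign remains. *)
Lemma collides_fold z w : collides P z w <->
  [/\ boundary T (fpos z), ~ A (fpos z), copy w = copy z, fpos w = fpos z
    & bounce (fpos z) (fvel z) (fvel w)] \/
  [/\ A (fpos z), copy w = ~~ copy z, fpos w = fpos z & fvel w = - fvel z].
Proof.
split.
  case=> [[/on_wall_fold[h1 h2] [cw pw /reflected_fold r]]|[/andreevC_fold Az [cw pw]]].
    by left; rewrite /fpos /fvel pw cw in h1 h2 *; split.
  move=> /reflected_fold/(bounce_andreev _ _ Az) r.
  right; rewrite /fpos /fvel cw pw fold_negb; split => //.
  have e : fold_dir (copy z) (vel w) = - mirror (fold_dir (copy z) (vel z)).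
    by rewrite -r fold_dirN opprK.
  by rewrite fold_dir_negb e mirrorN mirrorK.
case=> [[h1 h2 cw pw r]|[Az cw pw vw]].
  left; split; first exact/on_wall_fold.
  split=> //; first by rewrite -[LHS](foldK (copy w)) [X in fold _ X]pw cw foldK.
  by apply/reflected_fold; rewrite -[in fold_dir _ (vel w)]cw.
right; split; first exact/andreevC_fold.
split=> //.
  transitivity (fold (copy w) (fpos w)); first by rewrite /fpos foldK.
  by rewrite pw cw /fpos; case: (copy z).
apply/reflected_fold/(bounce_andreev _ _ Az).
rewrite fold_dirN -[fold_dir _ (vel w)]mirrorK -fold_dir_negb -cw -/(fvel w) vw.
by rewrite mirrorN opprK.
Qed.

Lemma fpos_retro z : fpos (retro z) = fpos z. Proof. exact: fold_negb. Qed.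
Lemma fvel_retro z : fvel (retro z) = - fvel z.
Proof. by rewrite /fvel /= fold_dirN fold_dir_negb; case: (copy z) => /=; rewrite !mirrorK. Qed.
Lemma retroK : involutive retro.
Proof.
move=> z; apply: state_eq; first exact: negbK.
  by rewrite !fpos_retro.
by rewrite !fvel_retro opprK.
Qed.

Lemma fvel_advance s z : fvel (advance s z) = fvel z. Proof. by []. Qed.

Lemma advance_retro s z : advance s (retro z) = retro (advance (- s) z).
Proof.
apply: state_eq => //.
by rewrite fpos_advance !fpos_retro fpos_advance fvel_retro scalerN scaleNr.
Qed.

Lemma advanceD s s' z : advance s (advance s' z) = advance (s' + s) z.
Proof. by case: z => b p v; rewrite /advance /= scalerDl addrA. Qed.
Lemma advance0 z : advance 0 z = z.
Proof. by case: z => b p v; rewrite /advance /= scale0r addr0. Qed.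

Lemma collides_fpos z w : collides P z w -> fpos w = fpos z.
Proof. by move=> /collides_fold[[]|[]]. Qed.

Lemma collides_boundary z w : collides P z w -> boundary T (fpos z).
Proof. by move=> /collides_fold[[]//|[/andreev_boundary]]. Qed.

Lemma collides_noninterior z w : collides P z w -> ~ O (fpos z).
Proof. by move=> /collides_boundary/boundaryE[]. Qed.

Lemma collides_retro z w : collides P z w -> collides P (retro w) (retro z).
Proof.
move=> /collides_fold H; apply/collides_fold; rewrite !fpos_retro !fvel_retro /=.
case: H => [[h1 h2 -> -> r]|[Az -> -> ->]]; [left|right].
  by split => //; exact: bounce_rev.
by split; rewrite ?negbK ?opprK.
Qed.

Lemma collides_fun z w w' : collides P z w -> collides P z w' -> w = w'.
Proof.
move=> /collides_fold[[h1 h2 cw pw r]|[Az cw pw vw]]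
  /collides_fold[[h1' h2' cw' pw' r']|[Az' cw' pw' vw']] //.
- by apply: state_eq; [rewrite cw cw'|rewrite pw pw'|exact: bounce_fun r r'].
- by apply: state_eq; [rewrite cw cw'|rewrite pw pw'|rewrite vw vw'].
Qed.

Lemma collides_andreev z w : A (fpos z) -> collides P z w -> w = retro z.
Proof.
move=> Az /collides_fold[[]//|[_ cw pw vw]].
by apply: state_eq => //; rewrite ?fpos_retro ?fvel_retro.
Qed.
End folding.

(** * Motions *)

Section motions.
Variables (R : realType) (P : andreev_billiard R) (cA lo hi : R).
Local Notation plane := (R * R)%type.
Implicit Types (p q u d x y : plane) (z w : state R).
Local Notation T := (table P).
Local Notation O := (table P)°.
Local Notation A := (andreev P).
Local Notation hit := (hit P).
Local Notation Sig := (singular_point P cA lo hi).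
Local Notation free := (free P cA lo hi).
Local Notation ends := (ends P cA lo hi).
Local Notation fpos := (fpos P).
Local Notation retro := (retro P).

Hypothesis lohi : lo < hi.
Hypothesis A_in : forall y : R, lo < y < hi -> A (cA, y).
Hypothesis A_out : forall p, A p -> p.1 = cA /\ lo <= p.2 <= hi.

Local Notation collides_fold := (collides_fold lohi A_in A_out).
Local Notation collides_fun := (collides_fun lohi A_in A_out).
Local Notation collides_retro := (collides_retro lohi A_in A_out).
Local Notation collides_noninterior := (collides_noninterior lohi A_in A_out).
Local Notation collides_fpos := (collides_fpos lohi A_in A_out).
Local Notation collides_andreev := (collides_andreev lohi A_in A_out).

Variables (a b : R) (c : R -> state R).
Hypothesis mc : motion P a b c.

Lemma motion_right t : a < t < b -> exists2 e, 0 < e &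
  forall s, 0 < s < e -> c (t + s) = advance s (c t) /\ O (fpos (c (t + s))).
Proof.
move=> /mc[/near0P[e e0 H] _]; exists e => // s /H[h1 /in_interior_fold h2].
by split.
Qed.

(** The left limit of the motion at [t], the motion itself being continuous from the right. *)
Definition pre t z := ((O (fpos z) /\ z = c t) \/ collides P z (c t)) /\
  exists2 e, 0 < e & forall s, 0 < s < e -> c (t - s) = advance (- s) z /\ O (fpos (c (t - s))).

Lemma motion_left t : a < t < b -> exists z, pre t z.
Proof.
move=> /mc[_ [z hz /near0P[e e0 H]]]; exists z; split.
  by case: hz => [[/in_interior_fold h1 h2]|h]; [left|right].
by exists e => // s /H[h1 /in_interior_fold h2]; split.
Qed.

Lemma pre_interior t z : O (fpos (c t)) -> pre t z -> z = c t.
Proof.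
move=> Oc [[[_ ->]//|co] _]; exfalso; apply: (collides_noninterior co).
by rewrite -(collides_fpos co).
Qed.

Lemma advance_inj s z w : advance s z = advance s w -> z = w.
Proof.
move=> /(congr1 (advance (- s))); rewrite !advanceD subrr !advance0 //.
Qed.

(** By determinism the future after [tau] is the image of the past under [retro]. Reversing time
    exchanges states before and after a collision, hence two statements, each comparing a value of
    [c] with a left limit. *)
Lemma retrace tau : a < tau < b -> A (fpos (c tau)) -> forall s, 0 <= s -> a < tau - s -> tau + s < b ->
  (forall z, pre (tau - s) z -> c (tau + s) = retro z) /\
  (0 < s -> forall z, pre (tau + s) z -> z = retro (c (tau - s))).
Proof.
move=> htau Atau s1 s10 as1 s1b.
pose Q s := s <= s1 ->
  (forall z, pre (tau - s) z -> c (tau + s) = retro z) /\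
  (0 < s -> forall z, pre (tau + s) z -> z = retro (c (tau - s))).
have Q0 : Q 0.
  move=> _; split; last by rewrite ltxx.
  rewrite subr0 addr0 => z [[[Oz zc]|co] _].
    by exfalso; have /boundaryE[_] := andreev_boundary Atau; rewrite -zc.
  by apply: collides_andreev => //; rewrite -(collides_fpos co).
suff : Q s1 by apply.
apply: contrapT => nQ.
have [s s0 Qs|t /andP[t0 ts1] [Ht nQt]] := first_time s10 nQ.
- have [s1s|ss1] := leP s1 s.
    exists 1 => // s' /andP[]; rewrite le_eqVlt => /orP[/eqP <- //|ss' _] h.
    by exfalso; lra.
  have [Qs1 _] := Qs (ltW ss1).
  have [|z pz] := motion_left (_ : a < tau - s < b); first by lra.
  have cz := Qs1 _ pz; have [_ [e e0 He]] := pz.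
  have [|e' e'0 He'] := motion_right (_ : a < tau + s < b); first by lra.
  have [m [m0 me me']] := lt_two e0 e'0.
  exists m => // s' /andP[]; rewrite le_eqVlt => /orP[/eqP <- //|ss' s'm] s's1.
  have [|r1 r2] := He' (s' - s); first by lra.
  have [|l1 l2] := He (s' - s); first by lra.
  have E1 : tau + s + (s' - s) = tau + s' by ring.
  have E2 : tau - s - (s' - s) = tau - s' by ring.
  rewrite E1 in r1 r2; rewrite E2 in l1 l2.
  have e_ : c (tau + s') = retro (c (tau - s')) by rewrite r1 cz advance_retro l1.
  split=> [y /(pre_interior l2) ->//|_ y /(pre_interior r2) -> //].
- have t0' : 0 < t by rewrite lt_neqAle t0 andbT; apply/eqP => t00; apply: nQt; rewrite -t00.
  apply: nQt => _.
  have [|z' pz'] := motion_left (_ : a < tau + t < b); first by lra.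
  have [|e e0 He] := motion_right (_ : a < tau - t < b); first by lra.
  (* The left limit at [tau + t] is determined by the flight just before, which is the image of the
     flight just after [tau - t]. *)
  have second (y : state R) : pre (tau + t) y -> y = retro (c (tau - t)).
    move=> [_ [e' e'0 He']].
    have [m [m0 me me']] := lt_two e0 e'0.
    have [r [r0 rm rt]] := lt_two m0 t0'.
    have [|r1 r2] := He r; first by lra.
    have [|l1 l2] := He' r; first by lra.
    have E1 : tau - t + r = tau - (t - r) by ring.
    have E2 : tau + t - r = tau + (t - r) by ring.
    rewrite E1 in r1 r2; rewrite E2 in l1 l2.
    have tr : 0 <= t - r < t by lra.
    have trs : t - r <= s1 by lra.
    have [Q1 _] := Ht _ tr trs.
    have [|w pw] := motion_left (_ : a < tau - (t - r) < b); first by lra.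
    have := Q1 _ pw; rewrite (pre_interior r2 pw) r1 l1 => h.
    by apply: (@advance_inj (- r)); rewrite h advance_retro opprK.
  split=> [y [[[Oy yc]|co] _]|_]; last exact: second.
    have [[[_ <-]|co']  _] := pz'; first by rewrite (second _ pz') yc.
    by exfalso; apply: (collides_noninterior co'); rewrite (second _ pz') fpos_retro -yc.
  have z'E := second _ pz'.
  have [[[Oz' _]|co']  _] := pz'.
    exfalso; apply: (collides_noninterior co).
    by rewrite -(collides_fpos co) -fpos_retro -z'E.
  by apply: collides_fun co' _; rewrite z'E; exact: collides_retro.
Qed.

Variable M : R.
Hypothesis M0 : 0 < M.
Hypothesis HM : forall x, T x -> `|x.1| <= M /\ `|x.2| <= M.
(** Two interior times of one flight differ by at most [4 * M]. As a flight may start on the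
    boundary, its first interior time is taken positive but below [M]. *)
Let Dt := 5 * M.

Lemma flight_bound x d (s s' : R) : dotp d d = 1 -> O (x + s *: d) -> O (x + s' *: d) ->
  s' - s <= 4 * M.
Proof.
move=> dd /interiorT/HM[h1 h2] /interiorT/HM[h1' h2'].
have [d1 d2] := unit_le1 dd.
move: h1 h2 h1' h2'; rewrite !planeE => h1 h2 h1' h2'.
have b1 : `|(s' - s) * d.1| <= 2 * M.
  have -> : (s' - s) * d.1 = (x.1 + s' * d.1) - (x.1 + s * d.1) by ring.
  by apply: le_trans (ler_normB _ _) _; lra.
have b2 : `|(s' - s) * d.2| <= 2 * M.
  have -> : (s' - s) * d.2 = (x.2 + s' * d.2) - (x.2 + s * d.2) by ring.
  by apply: le_trans (ler_normB _ _) _; lra.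
have -> : s' - s = (s' - s) * d.1 * d.1 + (s' - s) * d.2 * d.2.
  by rewrite -[LHS]mulr1 -dd /dotp; ring.
have k (e f : R) : `|e| <= 2 * M -> `|f| <= 1 -> e * f <= 2 * M.
  move=> he hf; apply: le_trans (ler_norm _) _; rewrite normrM.
  by rewrite -[2 * M]mulr1 ler_pM.
have := k _ _ b1 d1; have := k _ _ b2 d2; lra.
Qed.

Lemma flight t : a < t -> t + Dt < b -> dotp (fvel (c t)) (fvel (c t)) = 1 ->
  exists tau, [/\ 0 < tau <= Dt, hit (fpos (c t)) (fvel (c t)) (fpos (c (t + tau))),
    fpos (c (t + tau)) = fpos (advance tau (c t)) &
    collides P (advance tau (c t)) (c (t + tau))].
Proof.
move=> at_ tb dd.
have Dt0 : 0 < Dt by rewrite /Dt mulr_gt0.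
(* The guard [0 < s] is there because [c t] may be on the boundary. *)
pose Q s := 0 < s -> c (t + s) = advance s (c t) /\ O (fpos (c t) + s *: fvel (c t)).
have [|e e0 He] := motion_right (_ : a < t < b); first by lra.
have OE s : c (t + s) = advance s (c t) -> O (fpos (c (t + s))) -> O (fpos (c t) + s *: fvel (c t)).
  by move=> -> ; rewrite fpos_advance.
have Q0 s : 0 < s < e -> Q s by move=> hs _; have [h1 h2] := He s hs; split => //; exact: OE.
have nQ : ~ (forall s, 0 <= s <= Dt -> Q s).
  move=> H; have m0 : 0 < M by [].
  have [s [s0 se sM]] := lt_two e0 m0.
  have [|//|_ O1] := H s; first by rewrite /Dt; lra.
  have [|//|_ O2] := H Dt; first by rewrite lexx ltW.
  by have := flight_bound dd O1 O2; rewrite /Dt; lra.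
have [s' hs' nQs'] : exists2 s', 0 <= s' <= Dt & ~ Q s'.
  by apply: contrapT => H; apply: nQ => s hs; apply: contrapT => nQs; apply: H; exists s.
move: hs' => /andP[s'0 s'D].
have [|s s0 Qs|tau /andP[tau0 taus] [Ht nQt]] := @first_time R (fun s => s <= Dt -> Q s) 0 s' s'0.
- by move=> H; apply: nQs'; exact: H.
- have [Ds|sD] := ltP Dt s.
    by exists 1 => // s2 h2 h3; exfalso; lra.
  have [s00|s00] := leP s 0.
    have -> : s = 0 by lra.
    exists e => // s2 h2 h3 s20; apply: Q0 => //; lra.
  have [cs Os] := Qs sD s00.
  have [|e' e'0 He'] := motion_right (_ : a < t + s < b); first by lra.
  exists e' => // s2 /andP[]; rewrite le_eqVlt => /orP[/eqP <- //|ss2 s2e] s2D _.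
  have [|r1 r2] := He' (s2 - s); first by lra.
  have E1 : t + s + (s2 - s) = t + s2 by ring.
  rewrite E1 cs advanceD in r1 r2.
  have E2 : s + (s2 - s) = s2 by ring.
  by rewrite E2 in r1; split => //; exact: OE.
have tauD : tau <= Dt by exact: le_trans s'D.
have {}nQt : ~ Q tau by move=> h; apply: nQt.
have tau0' : 0 < tau.
  by rewrite lt_neqAle tau0 andbT; apply/eqP => t00; apply: nQt; rewrite -t00 /Q ltxx.
have [|z [hz [e' e'0 He']]] := motion_left (_ : a < t + tau < b); first by lra.
have zE : z = advance tau (c t).
  have [r [r0 re rt]] := lt_two e'0 tau0'.
  have [|l1 l2] := He' r; first by lra.
  have tr : 0 <= tau - r < tau by lra.
  have [||r1 r2] := Ht _ tr; [by lra|by lra|].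
  have E1 : t + tau - r = t + (tau - r) by ring.
  rewrite E1 r1 in l1; apply: (@advance_inj (- r)); rewrite -l1 advanceD.
  by congr (advance _ _); ring.
have Hfly s : 0 < s < tau -> O (fpos (c t) + s *: fvel (c t)).
  move=> /andP[s0 st]; have ts : 0 <= s < tau by lra.
  by have [||//] := Ht _ ts; lra.
case: hz => [[Oz zc]|co].
  by exfalso; apply: nQt => _; rewrite -zc zE -fpos_advance -zE.
rewrite zE in co; have fE := collides_fpos co.
exists tau; split => //; first by rewrite tau0'.
exists tau; split => //; first by rewrite fE fpos_advance.
by rewrite fE; exact: collides_noninterior co.
Qed.

Lemma hit_after t s : a < t < b -> ~ O (fpos (c t)) -> 0 < s ->
  (forall s', 0 < s' <= s -> c (t + s') = advance s' (c t) /\ O (fpos (c (t + s')))) ->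
  hit (fpos (c (t + s))) (- fvel (c (t + s))) (fpos (c t)).
Proof.
move=> ht nO s0 H; have [|cs Os] := H s; first by lra.
exists s; split => //; rewrite cs fpos_advance fvel_advance.
  by apply: plane_eq; rewrite !planeE; ring.
move=> s' hs'.
have -> : fpos (c t) + s *: fvel (c t) + s' *: - fvel (c t) = fpos (c t) + (s - s') *: fvel (c t).
  by apply: plane_eq; rewrite !planeE; ring.
by have [|cs' ] := H (s - s'); [lra|rewrite cs' fpos_advance].
Qed.

Variable d0 : plane.
Local Notation D := (direction P d0).
Hypothesis D_unit : forall d, D d -> dotp d d = 1.

(** A motion follows an itinerary as long as it meets regular walls. The third outcome is an
    endpoint of the segment outside the Andreev set: the motion legally bounces there, but the
    itinerary stops. *)
Lemma run m t : a < t -> t + m%:R * Dt < b -> D (fvel (c t)) ->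
  [\/ free m (fpos (c t)) (fvel (c t)),
      exists2 t', t < t' <= t + m%:R * Dt & A (fpos (c t'))
    | exists2 t', t < t' <= t + m%:R * Dt & [/\ D (fvel (c t')), Sig (fpos (c t')), ~ O (fpos (c t'))
      & exists k, ends k (fpos (c t)) (fvel (c t))]].
Proof.
have Dt0 : 0 < Dt by rewrite /Dt mulr_gt0.
elim: m t => [|m IH] t at_ tb Dv; first by constructor 1; exists [::], (fpos (c t)).
have mD : 0 <= m%:R * Dt by rewrite mulr_ge0 // ltW.
have E : m.+1%:R * Dt = m%:R * Dt + Dt by rewrite -natr1 mulrDl mul1r.
rewrite E in tb *.
have [|tau [/andP[tau0 tauD] hy yE co]] := flight at_ _ (D_unit Dv); first by lra.
have [[bd nA cw pw [i [si nv vi]]]|[Ay cw pw vw]] := (collides_fold _ _).1 co; last first.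
  by constructor 2; exists (t + tau); [lra|rewrite yE].
rewrite -yE in nA si; rewrite fvel_advance in vi.
have Dv' : D (fvel (c (t + tau))) by rewrite vi; exact: direction_rfl.
have [Sy|nSy] := pselect (Sig (fpos (c (t + tau)))).
  constructor 3; exists (t + tau); first by lra.
  split => //; first by have [? []] := hy.
  by exists 0%N, [::], (fpos (c t)), (fpos (c (t + tau))).
have h1 : a < t + tau by lra.
have h2 : t + tau + m%:R * Dt < b by lra.
have [[w [y [sw bw]]]|[t' ht' At']|[t' ht' [D' S' nO' [k [w [y [q [sw bw hq Sq]]]]]]]] := IH _ h1 h2 Dv'.
- constructor 1; exists (i :: w), y; split; first by rewrite /= sw.
  by exists (fpos (c (t + tau))) => //; split => //; rewrite -vi.
- by constructor 2; exists t' => //; lra.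
- constructor 3; exists t'; first by lra.
  split => //; exists k.+1, (i :: w), y, q; split => //=; [by rewrite sw| |by rewrite -vi].
  by exists (fpos (c (t + tau))) => //; split => //; rewrite -vi.
Qed.

Hypothesis no_connection : forall x d k k', O x -> D d -> ends k x d -> ends k' x (- d) -> False.
Variable N : nat.
Hypothesis not_free : forall x d, O x -> D d -> ~ free N x d.

(** One run of [N] bounces suffices unless it meets an endpoint of the segment. In that case a
    second run starts there, and it cannot meet a singular point again. *)
Lemma andreev_recurrence t : a < t -> t + (2 * (N%:R * Dt) + 1) < b -> D (fvel (c t)) ->
  exists2 t', t < t' <= t + (2 * (N%:R * Dt) + 1) & A (fpos (c t')).
Proof.
move=> at_ tb Dv.
have Dt0 : 0 < Dt by rewrite /Dt mulr_gt0.
have ND : 0 <= N%:R * Dt by rewrite mulr_ge0 // ltW.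
(* The bounds hold for interior points, so each run is preceded by a short advance. Two advances
   below [4^-1] fit in the extra [1]. *)
have h4 : 0 < 4^-1 :> R by rewrite invr_gt0.
have later (u : R) : a < u < b -> D (fvel (c u)) -> exists s, [/\ 0 < s, s < 4^-1, O (fpos (c (u + s))),
    D (fvel (c (u + s))) &
    forall s', 0 < s' <= s -> c (u + s') = advance s' (c u) /\ O (fpos (c (u + s')))].
  move=> hu Du; have [e e0 He] := motion_right hu; have [s [s0 se s4]] := lt_two e0 h4.
  exists s; have [|cs Os] := He s; first by lra.
  split => //; first by rewrite cs fvel_advance.
  by move=> s' hs'; apply: He; lra.
have [|s [s0 s4 Os Ds _]] := later t _ Dv; first by lra.
have h1 : a < t + s by lra.
have h2 : t + s + N%:R * Dt < b by lra.
have [/(not_free Os Ds)//|[t' ht' At']|[t' ht' [D' S' nO' _]]] := run h1 h2 Ds.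
- by exists t' => //; lra.
have [|s' [s'0 s'4 Os' Ds' Hs']] := later t' _ D'; first by lra.
have h1' : a < t' + s' by lra.
have h2' : t' + s' + N%:R * Dt < b by lra.
have [/(not_free Os' Ds')//|[t2 ht2 At2]|[t2 ht2 [_ _ _ [k ek]]]] := run h1' h2' Ds'.
- by exists t2 => //; lra.
(* Backwards from time [t' + s'], the orbit reaches the singular point of time [t'] without any
   bounce. *)
exfalso; apply: (no_connection Os' Ds' ek (k' := 0%N)).
exists [::], (fpos (c (t' + s'))), (fpos (c t')); split => //=.
by apply: hit_after => //; lra.
Qed.
End motions.

(** * Closing the orbits *)

Section closing.
Variables (R : realType) (P : andreev_billiard R) (cA lo hi : R).
Local Notation plane := (R * R)%type.
Implicit Types (p q u d x y : plane) (z w : state R).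
Local Notation O := (table P)°.
Local Notation A := (andreev P).
Local Notation fpos := (fpos P).

Hypothesis lohi : lo < hi.
Hypothesis A_in : forall y : R, lo < y < hi -> A (cA, y).
Hypothesis A_out : forall p, A p -> p.1 = cA /\ lo <= p.2 <= hi.

Variable d0 : plane.
Local Notation D := (direction P d0).

Lemma direction_mirror d : D d -> D (mirror d).
Proof.
move=> Dd; have Am : A (cA, (lo + hi) / 2) by apply: A_in; have := lohi; lra.
have [i [_ _ ->]] := (bounce_andreev lohi A_in A_out d (mirror d) Am).2 erefl.
exact: direction_rfl.
Qed.

Lemma direction_fold b d : D (fold_dir b d) <-> D d.
Proof.
case: b => //=; split=> [/direction_mirror|]; last exact: direction_mirror.
by rewrite mirrorK.
Qed.

Lemma direction_bounce y d d' : bounce P y d d' -> D d <-> D d'.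
Proof.
move=> [i [_ _ ->]]; split=> [|/(direction_rfl i)]; first exact: direction_rfl.
by rewrite reflect_dirK // edge_neq0.
Qed.

Lemma directionN d : D (- d) <-> D d.
Proof. by split=> [/direction_opp|/direction_opp//]; rewrite opprK. Qed.

Lemma direction_collides z w : collides P z w -> D (fvel z) <-> D (fvel w).
Proof.
move=> /(collides_fold lohi A_in A_out)[[_ _ _ _ /direction_bounce//]|[_ _ _ ->]].
exact: iff_sym (directionN _).
Qed.

Lemma direction_possible d : possible_direction P d0 d -> D d.
Proof.
elim=> {d} [|p q _ Dp co]; first exact: direction_start.
by apply/(direction_fold (copy q))/(direction_collides co)/direction_fold.
Qed.

Lemma direction_glued z w : glued P z w -> D (vel z) -> D (fvel w).
Proof.
move=> g /(direction_fold (copy w)) Dz.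
case: g => [[_ _ zw]|[_ _ cw _ H]|[_ _ [zw|[_ _ H]]]].
- by rewrite zw in Dz.
- case: H => [e|r]; first by rewrite e in Dz.
  exact: (direction_bounce ((@reflected_fold _ _ _ _ _ _).1 r)).2 Dz.
- by rewrite zw in Dz.
- apply: (direction_bounce ((@reflected_fold _ _ _ _ _ _).1 H)).2.
  by rewrite fold_dirN; apply/directionN.
Qed.

Lemma glued_refl (a b t : R) c : motion P a b c -> a < t < b -> glued P (c t) (c t).
Proof.
move=> mc /(motion_left mc)[z [[[Oz zc]|co] _]].
  by constructor 1; rewrite -zc; split => //; exact/in_interior_fold.
have bd := collides_boundary lohi A_in A_out co.
rewrite -(collides_fpos lohi A_in A_out co) in bd.
have [Ac|nAc] := pselect (A (fpos (c t))).
  by constructor 3; split; [exact/andreevC_fold|exact/andreevC_fold|left].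
by constructor 2; split => //; [exact/on_wall_fold|exact/on_wall_fold|left].
Qed.

Hypothesis D_unit : forall d, D d -> dotp d d = 1.
Variable N : nat.
Hypothesis not_free : forall x d, O x -> D d -> ~ free P cA lo hi N x d.
Hypothesis no_connection : forall x d k k', O x -> D d ->
  ends P cA lo hi k x d -> ends P cA lo hi k' x (- d) -> False.

(** Collisions at times [t1] and [t2] make the motion symmetric about both times, up to [retro]. The
    second one is looked for after [t1 + t1], so that both symmetries apply within positive times
    and the initial state. *)
Lemma closed_orbit (z : state R) : D (vel z) ->
  (forall t, exists W, flow P t (class P z) W) ->
  exists2 t, 0 < t & flow P t (class P z) (class P z).
Proof.
move=> Dz Hflow; have [M M0 HM] := table_bounded P.
pose L : R := 2 * (N%:R * (5 * M)) + 1.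
have L0 : 0 < L.
  have : 0 <= N%:R * (5 * M) :> R by rewrite mulr_ge0 // mulr_ge0 // ltW.
  by rewrite /L; lra.
(* Here [t1] is at most [L], [t2] at most [3 * L] and the period at most [4 * L], so a motion up to
   [5 * L] is long enough. *)
have [W [a [b [c [/andP[a0 b0] /andP[_ Lb] mc [st ZE _]]]]]] := Hflow (5 * L).
have h0 : a < 0 < b by rewrite a0.
have Dc0 : D (fvel (c 0)).
  apply: (@direction_glued z) => //.
  have : class P z (c 0) by rewrite ZE; split => //; exact: glued_refl mc h0.
  by case.
have rec t : a < t -> t + L < b -> D (fvel (c t)) -> exists2 t', t < t' <= t + L & A (fpos (c t')).
  exact: (andreev_recurrence lohi A_in A_out mc M0 HM D_unit no_connection not_free).
have L1 : 0 + L < b by lra.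
have [t1 /andP[t10 t1L] At1] := rec 0 a0 L1 Dc0.
rewrite add0r in t1L.
have h1 : a < t1 < b by lra.
have [R1 R2] := retrace lohi A_in A_out mc h1 At1 (ltW t10) ltac:(lra) ltac:(lra).
rewrite subrr in R1 R2.
have [z0 pz0] := motion_left mc h0.
have D2 : D (fvel (c (t1 + t1))).
  rewrite (R1 _ pz0) fvel_retro; apply/directionN.
  by case: pz0 => -[[_ ->//]|/direction_collides co] _; apply/co.
have L2 : t1 + t1 + L < b by lra.
have L2' : a < t1 + t1 by lra.
have [t2 /andP[t21 t2L] At2] := rec _ L2' L2 D2.
have h2 : a < t2 < b by lra.
have s0 : 0 <= t2 - (t1 + t1) by lra.
have [S1 _] := retrace lohi A_in A_out mc h2 At2 s0 ltac:(lra) ltac:(lra).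
have [|z1 pz1] := motion_left mc (_ : a < t1 + t1 < b); first by lra.
have e_ : t2 - (t2 - (t1 + t1)) = t1 + t1 by ring.
rewrite e_ in S1; have := S1 _ pz1; rewrite (R2 t10 _ pz1) retroK => cT.
(* The symmetry about [t1] takes time 0 to [t1 + t1], and the one about [t2] takes it on to this
   time; the two applications of [retro] cancel. *)
exists (t2 + (t2 - (t1 + t1))); first by lra.
exists a, b, c; split => //; first by lra.
by split => //; rewrite cT.
Qed.
End closing.

Lemma ae_dir (R : realType) (I : countType) (F : I -> R * R) :
  {ae @lebesgue_measure R, forall t, 0 <= t < 2 * pi -> forall i, dir t <> F i}.
Proof.
apply: negligibleS (negligible_dir F) => t /not_implyP[ht /existsNP[i /contrapT ti]].
by split => //; exists i.
Qed.

Theorem theorem2 (R : realType) (P : andreev_billiard R)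
    (Prat : rational_billiard P) :
  {ae @lebesgue_measure R, forall theta : R, 0 <= theta < 2 * pi ->
    closed_flow P (invariant_surface P theta)}.
Proof.
have [cA [lo [hi [lohi A_in A_out]]]] := andreev_interval P.
have [F HF] := generic_direction P cA lo hi.
(* Two directions join the countable family of connections: the vertical ones, along which no
   trajectory leaves the segment into the table. *)
apply: negligibleS (ae_dir
  (fun c => match c with inl i => F i | inr b => (0, (-1) ^+ (b : bool)) end)).
move=> theta nclosed gen; apply: nclosed => htheta.
have genF i := gen htheta (inl i); have genV b := gen htheta (inr b).
have Du := @direction_unit R P theta.
have nc x d k k' (_ : (table P)° x) := HF (dir theta) Du genF x d k k'.
have [Dl HDl] := directions_finite Prat theta.
have v0 : (dir theta).1 != 0.
  apply/eqP => /= c0; have := cos2Dsin2 theta; rewrite c0 expr0n /= add0r => /eqP.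
  rewrite sqrf_eq1 => /orP[/eqP s1|/eqP s1].
    by apply: (genV false); rewrite /dir c0 s1.
  by apply: (genV true); rewrite /dir c0 s1.
have [N HN] := free_bound lohi A_in A_out Du HDl v0 nc.
move=> _ [z [_ /(direction_possible lohi A_in A_out) Dz] <-] Hflow.
exact: (closed_orbit lohi A_in A_out Du HN nc Dz).
Qed.
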